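(* Let $H$ be a pointed Hopf algebra over a field $\mathbb{K}$ with finite group of grouplike elements $G=G(H)$ and invertible antipode. If $A=A_{par}$, then $$A\cong\bigoplus_{L\leq G}q(G,L)\,AP_L,$$ where the direct sum runs over the subgroups $L$ of $G$, $q(G,L)AP_L$ denotes the direct sum of $q(G,L)$ copies of $AP_L$, and $q(G,L)$ is the cardinality of the set $\{X\in\mathcal{P}_1(G)\mid G_X\text{ is conjugate to }L\}$.
   Context: Sweedler notation $\Delta(h)=h_{1}\otimes h_{2}$ is used; $S$ is the antipode of $H$; $\cong$ denotes isomorphism of algebras. A Hopf algebra is pointed if all its simple subcoalgebras are one-dimensional. The algebra $H_{par}$ is the quotient of the tensor algebra $T(H)$ by the relations $1_H=1_{T(H)}$, $h\otimes k_{1}\otimes S(k_{2})=hk_{1}\otimes S(k_{2})$ and $h_{1}\otimes S(h_{2})\otimes k=h_{1}\otimes S(h_{2})k$ for all $h,k\in H$; $[h]$ is the class of $h\in H$, and $\varepsilon_h=[h_1][S(h_2)]$. $A_{par}$ is the subalgebra of $H_{par}$ generated by all $\varepsilon_h$, $h\in H$. $\mathcal{P}_1(G)=\{X\subseteq G\mid 1_H\in X\}$ and, for $X\in\mathcal{P}_1(G)$, $P_X=\prod_{x\in X}\varepsilon_x\prod_{y\in G\setminus X}(1_A-\varepsilon_y)$, a central idempotent of $A$, so $AP_X$ is an algebra with unit $P_X$. For $X\in\mathcal{P}_1(G)$, $G_X=\{t\in G\mid tX=X\}$, a subgroup of $G$.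
   Formalization: The direct sum runs over one subgroup L from each conjugacy class of subgroups of G, not over all subgroups; over all subgroups the claim fails, e.g. for H = K[S_3], where A has dimension 32 but the literal sum has dimension 50. *)

(* Defs.v *)
From HB Require Import structures.
From mathcomp Require Import all_boot all_fingroup all_algebra generic_quotient ring_quotient.
From mathcomp Require Import finmap monalg.
From mathcomp Require Import boolp.

Set Implicit Arguments.
Unset Strict Implicit.
Unset Printing Implicit Defensive.

Import GRing.Theory.
Local Open Scope ring_scope.
Local Open Scope quotient_scope.

(* The operations on the quotients below are locked, to prevent unification    *)
(* from computing with representatives.                                        *)
Fact quot_key : unit. Proof. exact: tt. Qed.

Section QuotientSpace.
Variables (K : fieldType) (V : lmodType K) (R : V -> V -> Prop).

(* The subspace spanned by the differences x - y for x, y related by R. *)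
Inductive gen_subspace : V -> Prop :=
| gen_subspace_rel x y of R x y : gen_subspace (x - y)
| gen_subspace0 : gen_subspace 0
| gen_subspaceP a x y of gen_subspace x & gen_subspace y :
    gen_subspace (a *: x + y).

Definition gen_subspace_pred : {pred V} := fun x => `[< gen_subspace x >].

Fact gen_subspace_zmod_closed : zmod_closed gen_subspace_pred.
Proof.
split=> [|x y /asboolP Hx /asboolP Hy]; apply/asboolP.
  exact: gen_subspace0.
by rewrite addrC -scaleN1r; apply: gen_subspaceP.
Qed.

HB.instance Definition _ :=
  GRing.isZmodClosed.Build V gen_subspace_pred gen_subspace_zmod_closed.

Definition gen_subspace_zmod : zmodClosed V := gen_subspace_pred.

Definition quot_space : Type := Quotient.quot gen_subspace_zmod.

HB.instance Definition _ := GRing.Zmodule.on quot_space.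

Definition quot_space_pi : V -> quot_space :=
  locked_with quot_key (\pi_(Quotient.quot gen_subspace_zmod)).
Definition quot_space_repr (x : quot_space) : V :=
  repr (x : Quotient.quot gen_subspace_zmod).

Let quot_space_piE : quot_space_pi = \pi_(Quotient.quot gen_subspace_zmod).
Proof. by rewrite /quot_space_pi; case: quot_key. Qed.

Lemma quot_space_reprK : cancel quot_space_repr quot_space_pi.
Proof. by rewrite quot_space_piE; exact: reprK. Qed.

Lemma quot_space_piP x y :
  (quot_space_pi x = quot_space_pi y) <-> gen_subspace (x - y).
Proof.
have E : gen_subspace_pred (x - y) = (quot_space_pi x == quot_space_pi y).
  by rewrite quot_space_piE; apply: Quotient.idealrBE.
split=> [/eqP|H]; first by rewrite -E => /asboolP.
by apply/eqP; rewrite -E; apply/asboolP.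
Qed.

Lemma quot_space_piD x y :
  quot_space_pi (x + y) = quot_space_pi x + quot_space_pi y.
Proof.
by rewrite quot_space_piE; apply: (raddfD (\pi_(Quotient.quot gen_subspace_zmod))).
Qed.

Definition quot_space_scale : K -> quot_space -> quot_space := locked_with quot_key
  (fun a x => quot_space_pi (a *: quot_space_repr x)).

Lemma quot_space_piZ a x :
  quot_space_pi (a *: x) = quot_space_scale a (quot_space_pi x).
Proof.
rewrite /quot_space_scale; case: quot_key.
apply/quot_space_piP; rewrite -scalerBr -[_ *: _]addr0.
apply: gen_subspaceP (gen_subspace0).
by apply/quot_space_piP; rewrite quot_space_reprK.
Qed.

Fact quot_space_scaleA a b x :
  quot_space_scale a (quot_space_scale b x) = quot_space_scale (a * b) x.
Proof. by rewrite -[x]quot_space_reprK -!quot_space_piZ scalerA. Qed.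
Fact quot_space_scale1 : left_id 1 quot_space_scale.
Proof. by move=> x; rewrite -[x]quot_space_reprK -quot_space_piZ scale1r. Qed.
Fact quot_space_scaleDr : right_distributive quot_space_scale +%R.
Proof.
move=> a x y; rewrite -[x]quot_space_reprK -[y]quot_space_reprK.
by rewrite -quot_space_piD -!quot_space_piZ scalerDr quot_space_piD.
Qed.
Fact quot_space_scaleDl x :
  {morph quot_space_scale^~ x : a b / a + b >-> a + b}.
Proof.
move=> a b; rewrite -[x]quot_space_reprK -!quot_space_piZ scalerDl.
by rewrite quot_space_piD.
Qed.

HB.instance Definition _ := GRing.Zmodule_isLmodule.Build K quot_space
  quot_space_scaleA quot_space_scale1 quot_space_scaleDr quot_space_scaleDl.

Fact quot_space_pi_is_linear : linear quot_space_pi.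
Proof. by move=> a x y; rewrite quot_space_piD quot_space_piZ. Qed.
HB.instance Definition _ :=
  GRing.isLinear.Build K V quot_space _ quot_space_pi quot_space_pi_is_linear.

End QuotientSpace.

Section TensorProduct.
Variables (K : fieldType) (U V : lmodType K).

Inductive tensor_rel : {malg K[(U * V)%type]} -> {malg K[(U * V)%type]} -> Prop :=
| tensor_rel_l a u u' v :
    tensor_rel << (a *: u + u', v) >> (a *: << (u, v) >> + << (u', v) >>)
| tensor_rel_r a u v v' :
    tensor_rel << (u, a *: v + v') >> (a *: << (u, v) >> + << (u, v') >>).

Definition tensor : Type := quot_space tensor_rel.
HB.instance Definition _ := GRing.Lmodule.on tensor.

Definition tens (u : U) (v : V) : tensor := quot_space_pi tensor_rel << (u, v) >>.

(* [tensor_lift f t] is the image of t under the linear map induced by f: for  *)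
(* bilinear f and t = \sum_i u_i (x) v_i it is \sum_i f u_i v_i.  It is        *)
(* computed on an arbitrary representative, hence only meaningful when f is    *)
(* bilinear; see [tensor_liftE].                                               *)
Definition tensor_lift (W : lmodType K) (f : U -> V -> W) (t : tensor) : W :=
  let r := quot_space_repr t in
  \sum_(p <- msupp r) r@_p *: f p.1 p.2.

Section TensorLift.
Variables (W : lmodType K) (f : U -> V -> W).
Hypothesis fl : forall v, linear (f^~ v).
Hypothesis fr : forall u, linear (f u).

Let ev (r : {malg K[(U * V)%type]}) := \sum_(p <- msupp r) r@_p *: f p.1 p.2.

Let evw (d : {fset U * V}) r : (msupp r `<=` d)%fset ->
  ev r = \sum_(p <- d) r@_p *: f p.1 p.2.
Proof.
move=> le; rewrite /ev [LHS](big_fset_incl _ le) => //= p _ /mcoeff_outdom ->.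
by rewrite scale0r.
Qed.

Let evP : linear ev.
Proof.
move=> a r s.
pose d := (msupp r `|` msupp s `|` msupp (a *: r + s))%fset.
rewrite (@evw d r) ?(@evw d s) ?(@evw d (a *: r + s)).
- rewrite scaler_sumr -big_split /=; apply: eq_bigr => p _.
  by rewrite mcoeffD mcoeffZ scalerDl scalerA.
- exact: fsubsetUr.
- by rewrite /d fsubsetU // fsubsetUr.
- by rewrite /d -fsetUA fsubsetUl.
Qed.

Let evU p : ev << p >> = f p.1 p.2.
Proof.
rewrite /ev msuppU oner_eq0 big_seq_fset1 mcoeffU eqxx.
by rewrite /= mulr1n scale1r.
Qed.

Let evB x y : ev (x - y) = ev x - ev y.
Proof.
have -> : x - y = (-1) *: y + x by rewrite scaleN1r addrC.
by rewrite (evP (-1) y x) scaleN1r addrC.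
Qed.

Let ev_rel r : gen_subspace tensor_rel r -> ev r = 0.
Proof.
have ev0 : ev 0 = 0 by rewrite -(subrr 0) evB subrr.
elim=> {r} [x y [a u u' v|a u v v']||a x y _ Hx _ Hy] //.
- by rewrite evB evP !evU /= fl subrr.
- by rewrite evB evP !evU /= fr subrr.
- by rewrite evP Hx Hy scaler0 addr0.
Qed.

Let tensor_lift_pi r : tensor_lift f (quot_space_pi tensor_rel r) = ev r.
Proof.
apply/eqP; rewrite -subr_eq0 -[tensor_lift _ _]/(ev _) -evB; apply/eqP/ev_rel.
by apply/quot_space_piP; rewrite quot_space_reprK.
Qed.

Lemma tensor_lift_linear : linear (tensor_lift f).
Proof.
move=> a s t; rewrite -[s]quot_space_reprK -[t]quot_space_reprK.
have E : forall x y : quot_space tensor_rel,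
  a *: (x : tensor) + (y : tensor) = (a *: x + y : quot_space tensor_rel).
  by [].
by rewrite E -(quot_space_pi_is_linear tensor_rel) !tensor_lift_pi evP.
Qed.

Lemma tensor_liftE u v : tensor_lift f (tens u v) = f u v.
Proof. by rewrite tensor_lift_pi evU. Qed.

End TensorLift.
End TensorProduct.

Notation "u '\ox' v" := (tens u v) (at level 40, left associativity) : ring_scope.

Definition tensor_mul (K : fieldType) (A B : algType K) (s t : tensor A B) :
  tensor A B :=
  tensor_lift (fun a b => tensor_lift (fun c d => (a * c) \ox (b * d)) t) s.

HB.mixin Record isHopfAlgebra (K : fieldType) H of GRing.Algebra K H := {
  comul : H -> tensor H H;
  counit : H -> K;
  antipode : H -> H;
  comul_is_linear : linear comul;
  comul1 : comul 1 = 1 \ox 1;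
  comulM : forall h k, comul (h * k) = tensor_mul (comul h) (comul k);
  comulA : forall h,
    tensor_lift (fun a b : H =>
      tensor_lift (fun a1 a2 : H => a1 \ox (a2 \ox b)) (comul a)) (comul h)
    = tensor_lift (fun a b : H => a \ox comul b) (comul h);
  counit_is_scalar : scalar counit;
  counit1 : counit 1 = 1;
  counitM : {morph counit : h k / h * k};
  counitl : forall h, tensor_lift (fun a b : H => counit a *: b) (comul h) = h;
  counitr : forall h, tensor_lift (fun a b : H => counit b *: a) (comul h) = h;
  antipode_is_linear : linear antipode;
  antipodel : forall h,
    tensor_lift (fun a b : H => antipode a * b) (comul h) = (counit h)%:A;
  antipoder : forall h,
    tensor_lift (fun a b : H => a * antipode b) (comul h) = (counit h)%:A
}.

#[short(type="hopfAlgType")]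
HB.structure Definition HopfAlgebra (K : fieldType) :=
  {H of isHopfAlgebra K H & GRing.Algebra K H}.

Section Coalgebra.
Variables (K : fieldType) (H : hopfAlgType K).

(* [sweedler h (fun h1 h2 => F)] is the sum denoted F in Sweedler notation.    *)
Definition sweedler (W : lmodType K) (h : H) (f : H -> H -> W) : W :=
  @tensor_lift K H H W f (comul h).

Definition grouplike (h : H) : Prop := h <> 0 /\ comul h = h \ox h.

Definition subspace (C : H -> Prop) : Prop :=
  C 0 /\ forall a x y, C x -> C y -> C (a *: x + y).

Definition subcoalgebra (C : H -> Prop) : Prop :=
  subspace C /\
  forall c, C c -> exists s : seq (H * H),
    (forall p, p \in s -> C p.1 /\ C p.2) /\
    comul c = \sum_(p <- s) p.1 \ox p.2.

Definition simple_subcoalgebra (C : H -> Prop) : Prop :=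
  [/\ subcoalgebra C,
      exists2 c, C c & c <> 0
    & forall D : H -> Prop, subcoalgebra D -> (forall x, D x -> C x) ->
        (forall x, D x -> x = 0) \/ (forall x, C x -> D x)].

Definition one_dimensional (C : H -> Prop) : Prop :=
  exists2 c, c <> 0 & forall x, C x <-> exists a, x = a *: c.

Definition pointed : Prop :=
  forall C, simple_subcoalgebra C -> one_dimensional C.

End Coalgebra.

Section QuotientAlgebra.
Variables (K : fieldType) (A : algType K).

(* The two-sided ideal generated by the differences x - y for R x y. *)
Inductive gen_ideal (R : A -> A -> Prop) : A -> Prop :=
| gen_ideal_rel x y of R x y : gen_ideal R (x - y)
| gen_ideal0 : gen_ideal R 0
| gen_idealD x y of gen_ideal R x & gen_ideal R y : gen_ideal R (x + y)
| gen_idealMl a x of gen_ideal R x : gen_ideal R (a * x)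
| gen_idealMr a x of gen_ideal R x : gen_ideal R (x * a).

(* An [algType] is nontrivial by definition, so that only relations generating *)
(* a proper ideal define a quotient in [algType].                              *)
Record alg_rels := AlgRels {
  alg_rels_rel :> A -> A -> Prop;
  alg_rels_proper : ~ gen_ideal alg_rels_rel 1
}.

Lemma gen_ideal_ker (R : A -> A -> Prop) (chi : {rmorphism A -> K}) :
  (forall x y, R x y -> chi x = chi y) -> forall x, gen_ideal R x -> chi x = 0.
Proof.
move=> chiR x; elim=> {x} [x y /chiR||x y _ Hx _ Hy|a x _ Hx|a x _ Hx].
- by rewrite rmorphB => ->; rewrite subrr.
- exact: rmorph0.
- by rewrite rmorphD Hx Hy addr0.
- by rewrite rmorphM Hx mulr0.
- by rewrite rmorphM Hx mul0r.
Qed.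

Lemma gen_ideal_proper (R : A -> A -> Prop) (chi : {rmorphism A -> K}) :
  (forall x y, R x y -> chi x = chi y) -> ~ gen_ideal R 1.
Proof.
by move=> chiR /(gen_ideal_ker chiR)/eqP; rewrite rmorph1 oner_eq0.
Qed.

Variable R : alg_rels.

Definition gen_ideal_pred : {pred A} := fun x => `[< gen_ideal R x >].

Fact gen_ideal_zmod_closed : zmod_closed gen_ideal_pred.
Proof.
split=> [|x y /asboolP Hx /asboolP Hy]; apply/asboolP.
  exact: gen_ideal0.
by apply: gen_idealD => //; rewrite -mulN1r; apply: gen_idealMl.
Qed.

HB.instance Definition _ :=
  GRing.isZmodClosed.Build A gen_ideal_pred gen_ideal_zmod_closed.

Definition gen_ideal_zmod : zmodClosed A := gen_ideal_pred.

Definition quot_alg : Type := Quotient.quot gen_ideal_zmod.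
HB.instance Definition _ := GRing.Zmodule.on quot_alg.

Definition quot_alg_pi : A -> quot_alg :=
  locked_with quot_key (\pi_(Quotient.quot gen_ideal_zmod)).
Definition quot_alg_repr (x : quot_alg) : A := repr (x : Quotient.quot gen_ideal_zmod).

Let quot_alg_piE : quot_alg_pi = \pi_(Quotient.quot gen_ideal_zmod).
Proof. by rewrite /quot_alg_pi; case: quot_key. Qed.

Lemma quot_alg_reprK : cancel quot_alg_repr quot_alg_pi.
Proof. by rewrite quot_alg_piE; exact: reprK. Qed.

Lemma quot_alg_piP x y : (quot_alg_pi x = quot_alg_pi y) <-> gen_ideal R (x - y).
Proof.
have E : gen_ideal_pred (x - y) = (quot_alg_pi x == quot_alg_pi y).
  by rewrite quot_alg_piE; apply: Quotient.idealrBE.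
split=> [/eqP|H]; first by rewrite -E => /asboolP.
by apply/eqP; rewrite -E; apply/asboolP.
Qed.

Lemma quot_alg_piD x y : quot_alg_pi (x + y) = quot_alg_pi x + quot_alg_pi y.
Proof.
by rewrite quot_alg_piE; apply: (raddfD (\pi_(Quotient.quot gen_ideal_zmod))).
Qed.

Definition quot_alg_mul : quot_alg -> quot_alg -> quot_alg := locked_with quot_key
  (fun x y => quot_alg_pi (quot_alg_repr x * quot_alg_repr y)).
Definition quot_alg_scale : K -> quot_alg -> quot_alg := locked_with quot_key
  (fun a x => quot_alg_pi (a *: quot_alg_repr x)).

Lemma quot_alg_piM x y :
  quot_alg_pi (x * y) = quot_alg_mul (quot_alg_pi x) (quot_alg_pi y).
Proof.
rewrite /quot_alg_mul; case: quot_key.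
set x' := quot_alg_repr (quot_alg_pi x); set y' := quot_alg_repr (quot_alg_pi y).
have Ix : gen_ideal R (x - x') by apply/quot_alg_piP; rewrite quot_alg_reprK.
have Iy : gen_ideal R (y - y') by apply/quot_alg_piP; rewrite quot_alg_reprK.
apply/quot_alg_piP; rewrite -/x' -/y'.
have -> : x * y - x' * y' = (x - x') * y + x' * (y - y').
  by rewrite mulrBl mulrBr addrA subrK.
by apply: gen_idealD; [apply: gen_idealMr | apply: gen_idealMl].
Qed.

Lemma quot_alg_piZ a x : quot_alg_pi (a *: x) = quot_alg_scale a (quot_alg_pi x).
Proof.
rewrite /quot_alg_scale; case: quot_key.
apply/quot_alg_piP; rewrite -scalerBr -mulr_algl; apply: gen_idealMl.
by apply/quot_alg_piP; rewrite quot_alg_reprK.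
Qed.

Fact quot_alg_mulA : associative quot_alg_mul.
Proof.
move=> x y z; rewrite -[x]quot_alg_reprK -[y]quot_alg_reprK -[z]quot_alg_reprK.
by rewrite -!quot_alg_piM mulrA.
Qed.
Fact quot_alg_mul1l : left_id (quot_alg_pi 1) quot_alg_mul.
Proof. by move=> x; rewrite -[x]quot_alg_reprK -quot_alg_piM mul1r. Qed.
Fact quot_alg_mul1r : right_id (quot_alg_pi 1) quot_alg_mul.
Proof. by move=> x; rewrite -[x]quot_alg_reprK -quot_alg_piM mulr1. Qed.
Fact quot_alg_mulDl : left_distributive quot_alg_mul +%R.
Proof.
move=> x y z; rewrite -[x]quot_alg_reprK -[y]quot_alg_reprK -[z]quot_alg_reprK.
by rewrite -quot_alg_piD -!quot_alg_piM mulrDl quot_alg_piD.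
Qed.
Fact quot_alg_mulDr : right_distributive quot_alg_mul +%R.
Proof.
move=> x y z; rewrite -[x]quot_alg_reprK -[y]quot_alg_reprK -[z]quot_alg_reprK.
by rewrite -quot_alg_piD -!quot_alg_piM mulrDr quot_alg_piD.
Qed.
Fact quot_alg_1_neq0 : quot_alg_pi 1 != 0.
Proof.
apply/eqP => E; apply: (alg_rels_proper (a := R)); rewrite -[1]subr0.
apply/quot_alg_piP; rewrite E; apply: (addrI (quot_alg_pi 0)).
by rewrite -quot_alg_piD !addr0.
Qed.

HB.instance Definition _ := GRing.Zmodule_isNzRing.Build quot_alg
  quot_alg_mulA quot_alg_mul1l quot_alg_mul1r quot_alg_mulDl quot_alg_mulDr
  quot_alg_1_neq0.

Fact quot_alg_scaleA a b x :
  quot_alg_scale a (quot_alg_scale b x) = quot_alg_scale (a * b) x.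
Proof. by rewrite -[x]quot_alg_reprK -!quot_alg_piZ scalerA. Qed.
Fact quot_alg_scale1 : left_id 1 quot_alg_scale.
Proof. by move=> x; rewrite -[x]quot_alg_reprK -quot_alg_piZ scale1r. Qed.
Fact quot_alg_scaleDr : right_distributive quot_alg_scale +%R.
Proof.
move=> a x y; rewrite -[x]quot_alg_reprK -[y]quot_alg_reprK.
by rewrite -quot_alg_piD -!quot_alg_piZ scalerDr quot_alg_piD.
Qed.
Fact quot_alg_scaleDl x : {morph quot_alg_scale^~ x : a b / a + b >-> a + b}.
Proof.
by move=> a b; rewrite -[x]quot_alg_reprK -!quot_alg_piZ scalerDl quot_alg_piD.
Qed.

HB.instance Definition _ := GRing.Zmodule_isLmodule.Build K quot_alg
  quot_alg_scaleA quot_alg_scale1 quot_alg_scaleDr quot_alg_scaleDl.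

Fact quot_alg_scaleAl (a : K) (x y : quot_alg) : a *: (x * y) = (a *: x) * y.
Proof.
rewrite -[x]quot_alg_reprK -[y]quot_alg_reprK.
rewrite -[_ * _]quot_alg_piM -[LHS]quot_alg_piZ scalerAl.
by rewrite quot_alg_piM quot_alg_piZ.
Qed.
HB.instance Definition _ :=
  GRing.Lmodule_isLalgebra.Build K quot_alg quot_alg_scaleAl.

Fact quot_alg_scaleAr (a : K) (x y : quot_alg) : a *: (x * y) = x * (a *: y).
Proof.
rewrite -[x]quot_alg_reprK -[y]quot_alg_reprK.
rewrite -[_ * _]quot_alg_piM -[LHS]quot_alg_piZ scalerAr.
by rewrite quot_alg_piM quot_alg_piZ.
Qed.
HB.instance Definition _ :=
  GRing.Lalgebra_isAlgebra.Build K quot_alg quot_alg_scaleAr.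

Fact quot_alg_pi_is_linear : linear quot_alg_pi.
Proof. by move=> a x y; rewrite quot_alg_piD quot_alg_piZ. Qed.
HB.instance Definition _ :=
  GRing.isLinear.Build K A quot_alg _ quot_alg_pi quot_alg_pi_is_linear.
Fact quot_alg_pi_is_monoid_morphism : monoid_morphism quot_alg_pi.
Proof. by split=> // x y; rewrite quot_alg_piM. Qed.
HB.instance Definition _ :=
  GRing.isMonoidMorphism.Build A quot_alg quot_alg_pi
    quot_alg_pi_is_monoid_morphism.

End QuotientAlgebra.

Fact malg_scaleAr (K : fieldType) (M : monomType) (a : K) (x y : {malg K[M]}) :
  a *: (x * y) = x * (a *: y).
Proof.
apply/(@malgP M) => k.
rewrite mcoeffZ (malgMEw (fsubset_refl (msupp x)) (fsubset_refl (msupp y))).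
rewrite [x * _](malgMEw (fsubset_refl (msupp x)) (msuppZ_le a y)).
rewrite !(raddf_sum (mcoeff k)) mulr_sumr; apply: eq_bigr => i _ /=.
rewrite !(raddf_sum (mcoeff k)) mulr_sumr; apply: eq_bigr => j _ /=.
by rewrite !mcoeffU mcoeffZ mulrnAr mulrCA.
Qed.
Section FreeAlgebra.
Variables (K : fieldType) (I : choiceType).

Definition free_alg : Type := {malg K[{fmonom I}]}.
HB.instance Definition _ := GRing.Lalgebra.on free_alg.

HB.instance Definition _ :=
  GRing.Lalgebra_isAlgebra.Build K free_alg (@malg_scaleAr K {fmonom I}).

Definition free_gen (i : I) : free_alg := << fmu i >>.

Variable f : I -> K.
Definition fmonom_eval (m : {fmonom I}) : K := \prod_(i <- m : seq I) f i.
Fact fmonom_eval_mmorphism : mmorphism fmonom_eval.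
Proof.
split=> [x y|]; rewrite /fmonom_eval.
  by rewrite [mmul x y]fmmulE big_cat.
by rewrite [mone]fmoneE big_nil.
Qed.
HB.instance Definition _ :=
  isMultiplicative.Build _ K fmonom_eval fmonom_eval_mmorphism.

Definition free_alg_eval (x : free_alg) : K := mmap idfun fmonom_eval x.
Fact free_alg_eval_is_scalar : scalar free_alg_eval.
Proof. exact: (linearP (mmap idfun fmonom_eval)). Qed.
HB.instance Definition _ :=
  GRing.isLinear.Build K free_alg K _ free_alg_eval free_alg_eval_is_scalar.
Fact free_alg_eval_is_monoid_morphism : monoid_morphism free_alg_eval.
Proof.
by split; [apply: (rmorph1 (mmap idfun fmonom_eval))
          | apply: (rmorphM (mmap idfun fmonom_eval))].
Qed.
HB.instance Definition _ := GRing.isMonoidMorphism.Build free_alg K free_alg_eval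
  free_alg_eval_is_monoid_morphism.
Lemma free_alg_evalE i : free_alg_eval (free_gen i) = f i.
Proof.
by rewrite /free_alg_eval mmapU /= mul1r /fmonom_eval fmuE big_seq1.
Qed.

End FreeAlgebra.

Section TensorAlgebra.
Variables (K : fieldType) (V : lmodType K).

Local Notation gen := (@free_gen K V).

Inductive tensor_alg_rel : free_alg K V -> free_alg K V -> Prop :=
| tensor_alg_rel_linear a u v :
    tensor_alg_rel (gen (a *: u + v)) (a *: gen u + gen v).

Lemma free_alg_eval_rel (f : {scalar V}) x y :
  tensor_alg_rel x y -> free_alg_eval f x = @free_alg_eval K V f y.
Proof.
case=> a u v.
rewrite free_alg_evalE linearP.
by rewrite (linearP (@free_alg_eval K V f)) /= !free_alg_evalE.
Qed.

Fact tensor_alg_proper : ~ gen_ideal tensor_alg_rel 1.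
Proof. exact: (gen_ideal_proper (@free_alg_eval_rel \0)). Qed.

Definition tensor_alg : Type := quot_alg (AlgRels tensor_alg_proper).
HB.instance Definition _ := GRing.Algebra.on tensor_alg.

Definition tensor_gen (v : V) : tensor_alg :=
  quot_alg_pi (AlgRels tensor_alg_proper) (gen v).

Fact tensor_gen_is_linear : linear tensor_gen.
Proof.
move=> a u v; rewrite /tensor_gen -linearP; apply/quot_alg_piP.
exact/gen_ideal_rel/tensor_alg_rel_linear.
Qed.
HB.instance Definition _ :=
  GRing.isLinear.Build K V tensor_alg _ tensor_gen tensor_gen_is_linear.

Section Eval.
Variable f : {scalar V}.

Definition tensor_alg_eval (x : tensor_alg) : K :=
  @free_alg_eval K V f (quot_alg_repr x).

Let evalE x :
  tensor_alg_eval (quot_alg_pi (AlgRels tensor_alg_proper) x) = @free_alg_eval K V f x.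
Proof.
rewrite /tensor_alg_eval; set y := quot_alg_repr _.
have: gen_ideal tensor_alg_rel (y - x).
  by apply/(quot_alg_piP (AlgRels tensor_alg_proper)); rewrite quot_alg_reprK.
move=> /(gen_ideal_ker (@free_alg_eval_rel f)) /eqP.
by rewrite rmorphB subr_eq0 => /eqP.
Qed.

Fact tensor_alg_eval_is_scalar : scalar tensor_alg_eval.
Proof.
move=> a x y.
rewrite -[x](@quot_alg_reprK _ _ (AlgRels tensor_alg_proper)).
rewrite -[y](@quot_alg_reprK _ _ (AlgRels tensor_alg_proper)).
by rewrite -(linearP (quot_alg_pi (AlgRels tensor_alg_proper))) !evalE linearP.
Qed.
HB.instance Definition _ :=
  GRing.isLinear.Build K tensor_alg K _ tensor_alg_eval tensor_alg_eval_is_scalar.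

Fact tensor_alg_eval_is_monoid_morphism : monoid_morphism tensor_alg_eval.
Proof.
split=> [|x y].
  by rewrite -(rmorph1 (quot_alg_pi (AlgRels tensor_alg_proper))) evalE rmorph1.
rewrite -[x](@quot_alg_reprK _ _ (AlgRels tensor_alg_proper)).
rewrite -[y](@quot_alg_reprK _ _ (AlgRels tensor_alg_proper)).
by rewrite -(rmorphM (quot_alg_pi (AlgRels tensor_alg_proper))) !evalE rmorphM.
Qed.
HB.instance Definition _ := GRing.isMonoidMorphism.Build tensor_alg K
  tensor_alg_eval tensor_alg_eval_is_monoid_morphism.

Lemma tensor_alg_evalE v : tensor_alg_eval (tensor_gen v) = f v.
Proof. by rewrite evalE free_alg_evalE. Qed.

End Eval.
End TensorAlgebra.

Section PartialHopf.
Variables (K : fieldType) (H : hopfAlgType K).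

HB.instance Definition _ :=
  GRing.isLinear.Build K H K _ (@counit K H) counit_is_scalar.

Local Notation ι := (@tensor_gen K H).

Inductive Hpar_rel : tensor_alg H -> tensor_alg H -> Prop :=
| Hpar_rel_unit : Hpar_rel (ι 1) 1
| Hpar_rel_left h k :
    Hpar_rel
      (sweedler k (fun k1 k2 => ι h * ι k1 * ι (antipode k2)))
      (sweedler k (fun k1 k2 => ι (h * k1) * ι (antipode k2)))
| Hpar_rel_right h k :
    Hpar_rel
      (sweedler h (fun h1 h2 => ι h1 * ι (antipode h2) * ι k))
      (sweedler h (fun h1 h2 => ι h1 * ι (antipode h2 * k))).

Fact Hpar_proper : ~ gen_ideal Hpar_rel 1.
Proof.
pose f : {scalar H} := @counit K H; pose chi := @tensor_alg_eval K H f.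
have chiM x y : chi (x * y) = chi x * chi y by apply: rmorphM.
have chiE h : chi (ι h) = counit h by apply: tensor_alg_evalE.
have chi_sweedler h (g1 g2 : H -> H -> tensor_alg H) :
    (forall u v, chi (g1 u v) = chi (g2 u v)) ->
    chi (sweedler h g1) = chi (sweedler h g2).
  move=> E; rewrite [LHS](linear_sum chi) [RHS](linear_sum chi).
  apply: eq_bigr => p _.
  by rewrite [LHS](linearZ_LR chi) [RHS](linearZ_LR chi); congr (_ * _); apply: E.
apply: (@gen_ideal_proper _ _ _ chi) => x y.
case=> [|h k|h k]; first by rewrite [LHS]chiE counit1 [RHS]rmorph1.
- by apply: chi_sweedler => u v; rewrite !chiM !chiE counitM.
- by apply: chi_sweedler => u v; rewrite !chiM !chiE counitM mulrA.
Qed.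

Definition Hpar : Type := quot_alg (AlgRels Hpar_proper).
HB.instance Definition _ := GRing.Algebra.on Hpar.

(* The class [h] of h in Hpar. *)
Definition brak (h : H) : Hpar := quot_alg_pi (AlgRels Hpar_proper) (ι h).

Definition eps_Hpar (h : H) : Hpar :=
  sweedler h (fun h1 h2 => brak h1 * brak (antipode h2)).

Inductive in_Apar : Hpar -> Prop :=
| in_Apar_eps h : in_Apar (eps_Hpar h)
| in_Apar1 : in_Apar 1
| in_AparP a x y of in_Apar x & in_Apar y : in_Apar (a *: x + y)
| in_AparM x y of in_Apar x & in_Apar y : in_Apar (x * y).

Definition Apar_pred : {pred Hpar} := fun x => `[< in_Apar x >].

Fact Apar_subalg_closed : subalg_closed Apar_pred.
Proof.
split=> [|a x y /asboolP Hx /asboolP Hy|x y /asboolP Hx /asboolP Hy];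
  apply/asboolP.
- exact: in_Apar1.
- exact: in_AparP.
- exact: in_AparM.
Qed.
HB.instance Definition _ :=
  GRing.isSubalgClosed.Build K Hpar Apar_pred Apar_subalg_closed.

Record Apar : predArgType :=
  InApar { Apar_val :> Hpar; _ : Apar_val \in Apar_pred }.
HB.instance Definition _ := [isSub for Apar_val].
HB.instance Definition _ := [Choice of Apar by <:].
HB.instance Definition _ := [SubChoice_isSubAlgebra of Apar by <:].

Fact eps_in_Apar h : eps_Hpar h \in Apar_pred.
Proof. exact/asboolP/in_Apar_eps. Qed.

Definition eps (h : H) : Apar := InApar (eps_in_Apar h).

End PartialHopf.

Section GrouplikeIdempotents.
Variables (K : fieldType) (H : hopfAlgType K) (gT : finGroupType) (g : gT -> H).

(* g identifies the finite group gT with the group G(H).                       *)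
Definition is_grouplike_group : Prop :=
  [/\ injective g,
      {morph g : x y / (x * y)%g >-> x * y}
    & forall h, grouplike h <-> exists x, h = g x].

(* The factors of both products commute, so that the order of multiplication   *)
(* (the one of the enumeration of gT) is irrelevant.                           *)
Definition PX (X : {set gT}) : Apar H :=
  \prod_(x in X) eps (g x) * \prod_(y in ~: X) (1 - eps (g y)).

End GrouplikeIdempotents.

Section Subgroups.
Variable gT : finGroupType.

Definition P1 : {set {set gT}} := [set X : {set gT} | 1%g \in X].

Definition GX (X : {set gT}) : {set gT} := [set t : gT | (t *: X)%g == X].

Definition qG (L : {group gT}) : nat :=
  #|[set X in P1 | [exists x : gT, GX X == (L :^ x)%g]]|.

Definition conjugacy_representatives (R : {set {group gT}}) : Prop :=
  forall L : {group gT},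
    exists! M : {group gT}, M \in R /\ exists x : gT, M :=: (L :^ x)%g.

(* q(G,L) summands for each L in R.  As q(G,L) counts the X for which G_X is   *)
(* conjugate to L, and not only those with G_X = L, each conjugacy class of    *)
(* subgroups has to contribute exactly once.                                   *)
Definition summand (R : {set {group gT}}) : finType :=
  {p : {L : {group gT} & 'I_(qG L)} | tag p \in R}.

Definition summand_group (R : {set {group gT}}) (i : summand R) : {group gT} :=
  tag (val i).

End Subgroups.

(* A e = {a e | a in A}, an algebra with unit e for the multiplication of A    *)
(* when e is a central idempotent of A.                                        *)
Definition corner (K : fieldType) (A : algType K) (e : A) (x : A) : Prop :=
  exists a : A, x = a * e.

(* A is isomorphic, as a unital K-algebra, to the direct sum of the A (e i),   *)
(* which is the set of the families y with y i in A (e i), with componentwise  *)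
(* operations and unit e.                                                      *)
Definition isom_sum_corners (K : fieldType) (A : algType K) (I : finType)
    (e : I -> A) : Prop :=
  exists f : {linear A -> {ffun I -> A}},
    [/\ injective f,
        forall y : {ffun I -> A},
          (exists a, y = f a) <-> (forall i, corner (e i) (y i)),
        forall i, f 1 i = e i
      & forall a b i, f (a * b) i = f a i * f b i].

(* Main.v *)
Require Import Defs.
From HB Require Import structures.
From mathcomp Require Import all_boot all_fingroup all_algebra.
From mathcomp Require Import boolp functions monalg finmap.
From mathcomp Require classical_sets.

Set Implicit Arguments.
Unset Strict Implicit.
Unset Printing Implicit Defensive.

Import GRing.Theory.
Local Open Scope ring_scope.

(** Write ε : H -> A for the map sending h to ε_h, G for G(H), and let Hom(H, A)
carry the convolution product; for k in H put (T_k f)(h) = f(hk).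

The proof rests on three facts.

- Relations.  ε * ε = ε, and ε commutes with T_k ε for every k in H
  ([epsc_idem], [translate_epsc_comm]).  Evaluated at grouplikes this says that
  the ε_x with x in G are central idempotents.  Hence the P_X, for X containing
  1, are central orthogonal idempotents, and an element killed by all of them
  vanishes ([PX_separate]): A is the direct sum of the corners A P_X.

- Universality.  If u in Hom(H, B) satisfies the two relations above, then some
  multiplicative linear map A -> B sends each ε_h to u(h) ([Apar_universal]).
  This is proved by letting H_par act on Hom(H, B): compressing the action of H
  by translations to the range of the projection f |-> u * f gives a partial
  representation of H, under which ε_h becomes left multiplication by
  u * T_h u, and evaluating at 1 turns the action of A into the map wanted.

- Rigidity.  When H is pointed, two commuting idempotents of Hom(H, B) which
  agree on G are equal ([conv_idem_inj]).  Classically, a map vanishing on the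
  coradical KG is locally nilpotent for the convolution product; the argument
  used here avoids the coradical filtration and, given a proper subcoalgebra M,
  finds an element outside M that is skew-primitive modulo M ([exists_skew]).

The translates T_x ε with x in G generate a Boolean algebra of commuting
idempotents ([boolean]), all of which commute with all T_k ε.  After
multiplication by P_X, such an idempotent is determined by its restriction to
G, and T_x ε restricts to the indicator function of X x^-1.  The sets X x^-1
generate the Boolean algebra whose atoms are the right cosets of G_X.  So if
G_X = G_Y, then Y is a Boolean combination of translates of X and conversely;
by universality the corresponding idempotents define algebra maps between A P_X
and A P_Y, and by rigidity these maps are mutually inverse
([corner_iso_stabilizer]).

In particular A P_X is isomorphic to A P_(G_X).  Conjugation by a grouplike
induces an automorphism of A carrying P_L to P_M whenever M is conjugate to L
([corner_iso_conj]).  Since each X containing 1 is counted by q(G, L) for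
exactly one representative L, regrouping the corners gives the theorem. *)

(** * Linearity *)

(** Closes the linearity side conditions of the Sweedler calculus, for
expressions built from linear maps, products and scalings. *)
Ltac lin := let a := fresh "a" in let x := fresh "x" in let y := fresh "y" in
  move=> a x y /=;
  do ?[progress rewrite ?(linearP, mulrDl, mulrDr, scalerDl, scalerDr)
                        -?(scalerAl, scalerAr)]; by [].

Section LinearPredicate.
Variables (K : fieldType) (U V : lmodType K) (f : U -> V).
Hypothesis fl : linear f.

Definition linear_of : {linear U -> V} :=
  HB.pack f (GRing.isLinear.Build K U V _ f fl).

Lemma linear_of0 : f 0 = 0.
Proof. exact: (raddf0 linear_of). Qed.
Lemma linear_ofZ a x : f (a *: x) = a *: f x.
Proof. exact: (linearZ_LR linear_of). Qed.
Lemma linear_ofD x y : f (x + y) = f x + f y.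
Proof. exact: (raddfD linear_of). Qed.
Lemma linear_ofN x : f (- x) = - f x.
Proof. exact: (raddfN linear_of). Qed.
Lemma linear_ofB x y : f (x - y) = f x - f y.
Proof. exact: (raddfB linear_of). Qed.
Lemma linear_of_sum I (r : seq I) (P : pred I) E :
  f (\sum_(i <- r | P i) E i) = \sum_(i <- r | P i) f (E i).
Proof. exact: (raddf_sum linear_of). Qed.

End LinearPredicate.

(** * Tensors and Sweedler sums *)

Section TensorCalculus.
Variables (K : fieldType).

(** Whatever [f] is, [tensor_lift f t] is a sum over one fixed representative of
[t], and linear maps go through it. *)
Lemma tensor_lift_comp (U V W W' : lmodType K) (f : U -> V -> W) (phi : W -> W')
    (t : tensor U V) :
  linear phi ->
  phi (tensor_lift f t) = tensor_lift (fun u v => phi (f u v)) t.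
Proof.
move=> phil; rewrite /tensor_lift (linear_of_sum phil).
by apply: eq_bigr => p _; rewrite (linear_ofZ phil).
Qed.

Lemma tensor_lift_ext (U V W : lmodType K) (f f' : U -> V -> W) (t : tensor U V) :
  f =2 f' -> tensor_lift f t = tensor_lift f' t.
Proof. by move=> E; apply: eq_bigr => p _; rewrite E. Qed.

Lemma tensor_lift_sum (U V W : lmodType K) (f : U -> V -> W) s :
  (forall v, linear (f^~ v)) -> (forall u, linear (f u)) ->
  tensor_lift f (\sum_(p <- s) p.1 \ox p.2) = \sum_(p <- s) f p.1 p.2.
Proof.
move=> fl fr; rewrite (linear_of_sum (tensor_lift_linear fl fr)).
by apply: eq_bigr => p _; rewrite tensor_liftE.
Qed.

Lemma tens_linearl (U V : lmodType K) (v : V) : linear (fun u : U => u \ox v).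
Proof.
move=> a u u'; rewrite /tens -linearP; apply/quot_space_piP.
exact/gen_subspace_rel/tensor_rel_l.
Qed.

Lemma tens_linearr (U V : lmodType K) (u : U) : linear (fun v : V => u \ox v).
Proof.
move=> a v v'; rewrite /tens -linearP; apply/quot_space_piP.
exact/gen_subspace_rel/tensor_rel_r.
Qed.

Lemma tensor_sum (U V : lmodType K) (t : tensor U V) :
  exists s : seq (U * V), t = \sum_(p <- s) p.1 \ox p.2.
Proof.
exists [seq ((quot_space_repr t)@_p *: p.1, p.2) | p <- msupp (quot_space_repr t)].
rewrite big_map -[LHS]quot_space_reprK {1}[quot_space_repr t]monalgE linear_sum.
apply: eq_bigr => p _ /=.
have -> : << (quot_space_repr t)@_p *g p >> = (quot_space_repr t)@_p *: << p >>.
  by move=> *; apply/malgP => q; rewrite mcoeffZ !mcoeffU mulr_natr.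
by rewrite linearZ /= (linear_ofZ (@tens_linearl U V p.2)); case: p.
Qed.

End TensorCalculus.

(** A [sweedler] sum is a sum over a fixed representative of the coproduct.  It
therefore commutes with linear maps and with other sums whatever its summand;
bilinearity only matters where the coproduct is rewritten. *)
Section Sweedler.
Variables (K : fieldType) (H : hopfAlgType K).
Implicit Types h k : H.
Local Notation swd := (@sweedler K H _).

Lemma sweedler_comp (W W' : lmodType K) (f : H -> H -> W) (phi : W -> W') h :
  linear phi -> phi (swd h f) = swd h (fun a b => phi (f a b)).
Proof. exact: tensor_lift_comp. Qed.

Lemma eq_sweedler (W : lmodType K) (f f' : H -> H -> W) h :
  f =2 f' -> swd h f = swd h f'.
Proof. exact: tensor_lift_ext. Qed.

Lemma sweedlerD (W : lmodType K) (f f' : H -> H -> W) h :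
  swd h (fun a b => f a b + f' a b) = swd h f + swd h f'.
Proof. by rewrite -big_split; apply: eq_bigr => p _; rewrite scalerDr. Qed.

Lemma sweedlerZ (W : lmodType K) (f : H -> H -> W) h c :
  swd h (fun a b => c *: f a b) = c *: swd h f.
Proof.
by rewrite scaler_sumr; apply: eq_bigr => p _; rewrite !scalerA mulrC.
Qed.

Lemma exchange_sweedler (W : lmodType K) (f : H -> H -> H -> H -> W) h k :
  swd h (fun a b => swd k (fun c d => f a b c d))
  = swd k (fun c d => swd h (fun a b => f a b c d)).
Proof.
rewrite /sweedler /tensor_lift.
under eq_bigr do rewrite scaler_sumr.
rewrite exchange_big; apply: eq_bigr => q _; rewrite scaler_sumr.
by apply: eq_bigr => p _; rewrite !scalerA mulrC.
Qed.

Lemma sweedler_linear_param (U W : lmodType K) (f : U -> H -> H -> W) h :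
  (forall a b, linear (fun u => f u a b)) -> linear (fun u => swd h (f u)).
Proof.
move=> fl c u u'; rewrite -sweedlerZ -sweedlerD.
by apply: eq_sweedler => a b; rewrite fl.
Qed.

Lemma sweedler_mull (B : algType K) (f : H -> H -> B) b h :
  b * swd h f = swd h (fun x y => b * f x y).
Proof. by apply: (@sweedler_comp _ _ _ ( *%R b)); lin. Qed.

Lemma sweedler_mulr (B : algType K) (f : H -> H -> B) b h :
  swd h f * b = swd h (fun x y => f x y * b).
Proof. by apply: (@sweedler_comp _ _ _ ( *%R^~ b)); lin. Qed.

Section Bilinear.
Variables (W : lmodType K) (f : H -> H -> W).
Hypotheses (fl : forall v, linear (f^~ v)) (fr : forall u, linear (f u)).

Lemma sweedler_linear : linear (fun h => swd h f).
Proof.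
by move=> a h k; rewrite /sweedler comul_is_linear; apply: tensor_lift_linear.
Qed.

Lemma sweedler_sum h s :
  comul h = \sum_(p <- s) p.1 \ox p.2 -> swd h f = \sum_(p <- s) f p.1 p.2.
Proof. by rewrite /sweedler => ->; exact: tensor_lift_sum. Qed.

Lemma sweedler1 : swd 1 f = f 1 1.
Proof. by rewrite /sweedler comul1 tensor_liftE. Qed.

Lemma sweedler_grouplike g : grouplike g -> swd g f = f g g.
Proof. by case=> _; rewrite /sweedler => ->; rewrite tensor_liftE. Qed.

Lemma sweedlerM h k :
  swd (h * k) f = swd h (fun a b => swd k (fun c d => f (a * c) (b * d))).
Proof.
rewrite /sweedler comulM /tensor_mul.
have L := tensor_lift_linear fl fr.
rewrite (tensor_lift_comp _ _ L); apply: tensor_lift_ext => a b.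
rewrite (tensor_lift_comp _ _ L); apply: tensor_lift_ext => c d.
exact: tensor_liftE.
Qed.

End Bilinear.

(** Coassociativity: a trilinear [f] induces a linear map on H (x) (H (x) H),
which is applied to both sides of [comulA]. *)
Lemma sweedlerA (W : lmodType K) (f : H -> H -> H -> W) h :
  (forall b c, linear (fun a => f a b c)) ->
  (forall a c, linear (fun b => f a b c)) ->
  (forall a b, linear (f a b)) ->
  swd h (fun x c => swd x (fun a b => f a b c))
  = swd h (fun a y => swd y (fun b c => f a b c)).
Proof.
move=> f1 f2 f3.
pose F a (t : tensor H H) := tensor_lift (f a) t.
have Fr a : linear (F a) by apply: tensor_lift_linear.
have Fl t : linear (F^~ t).
  move=> c a b; rewrite /F /tensor_lift scaler_sumr -big_split.
  by apply: eq_bigr => p _ /=; rewrite f1 scalerDr !scalerA mulrC.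
have L := tensor_lift_linear Fl Fr.
have := congr1 (tensor_lift F) (comulA h).
rewrite [LHS](tensor_lift_comp _ _ L) [RHS](tensor_lift_comp _ _ L) => E.
transitivity (swd h (fun x c => tensor_lift F
    (tensor_lift (fun a b => a \ox (b \ox c)) (comul x)))).
  apply: eq_sweedler => x c; rewrite [RHS](tensor_lift_comp _ _ L).
  apply: tensor_lift_ext => a b.
  by rewrite (tensor_liftE Fl Fr) /F (tensor_liftE (f2 a) (f3 a)).
by rewrite [LHS]E; apply: tensor_lift_ext => a b; rewrite (tensor_liftE Fl Fr).
Qed.

Lemma sweedler_counitl (W : lmodType K) (f : H -> W) h :
  linear f -> swd h (fun a b => counit a *: f b) = f h.
Proof.
move=> fl; rewrite -[in RHS](counitl h) (tensor_lift_comp _ _ fl).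
by apply: tensor_lift_ext => a b; rewrite (linear_ofZ fl).
Qed.

Lemma sweedler_counitr (W : lmodType K) (f : H -> W) h :
  linear f -> swd h (fun a b => counit b *: f a) = f h.
Proof.
move=> fl; rewrite -[in RHS](counitr h) (tensor_lift_comp _ _ fl).
by apply: tensor_lift_ext => a b; rewrite (linear_ofZ fl).
Qed.

End Sweedler.

(** * The convolution algebra *)

Section Conv.
Variables (K : fieldType) (H : hopfAlgType K).
Implicit Types h k : H.
Local Notation swd := (@sweedler K H _).

Definition linear_pred (B : lmodType K) : {pred H -> B} := fun f => `[< linear f >].

Fact linear_pred_submod_closed (B : lmodType K) : submod_closed (@linear_pred B).
Proof.
split=> [|c f f' /asboolP fl /asboolP fl']; apply/asboolP => a x y.
  by rewrite /= scaler0 addr0.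
rewrite !fctE fl fl' !scalerDr !scalerA mulrC -!addrA; congr (_ + _).
by rewrite addrCA.
Qed.

HB.instance Definition _ (B : lmodType K) :=
  GRing.isSubmodClosed.Build K (H -> B) (@linear_pred B) (@linear_pred_submod_closed B).

(** The linear maps from H to B, as a subtype of the functions so that it
inherits their module structure; it carries the convolution product, not the
pointwise one. *)
Record conv (B : lmodType K) : predArgType :=
  Conv { conv_fun :> H -> B; _ : conv_fun \in @linear_pred B }.

Section ConvLmod.
Variable B : lmodType K.
HB.instance Definition _ := [isSub for @conv_fun B].
HB.instance Definition _ := [Choice of conv B by <:].
HB.instance Definition _ := [SubChoice_isSubLmodule of conv B by <:].

Fact conv_is_linear (f : conv B) : linear f.
Proof. by case: f => f /= /asboolP. Qed.
HB.instance Definition _ f :=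
  GRing.isLinear.Build K H B _ (conv_fun f) (@conv_is_linear f).

Definition to_conv (f : H -> B) (fl : linear f) : conv B := Conv (asboolT fl).

Lemma to_convE f fl : @to_conv f fl =1 f.
Proof. by []. Qed.

Lemma convP (f f' : conv B) : f =1 f' -> f = f'.
Proof. by move=> E; apply: val_inj; apply/funext. Qed.

Lemma convD (f f' : conv B) h : (f + f') h = f h + f' h. Proof. by []. Qed.
Lemma convB (f f' : conv B) h : (f - f') h = f h - f' h. Proof. by []. Qed.
Lemma convZ a (f : conv B) h : (a *: f) h = a *: f h. Proof. by []. Qed.

End ConvLmod.

Section ConvAlgebra.
Variable B : algType K.
Implicit Types f : conv B.

Fact conv_mul_linear f f' : linear (fun h => swd h (fun a b => f a * f' b)).
Proof. by apply: sweedler_linear => ?; lin. Qed.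
Definition conv_mul f f' := to_conv (conv_mul_linear f f').

Fact conv_one_linear : linear (fun h => (counit h)%:A : B).
Proof. by move=> a x y; rewrite counit_is_scalar scalerDl scalerA. Qed.
Definition conv_one := to_conv conv_one_linear.

Fact conv_mulA : associative conv_mul.
Proof.
move=> f1 f2 f3; apply: convP => h /=; symmetry.
transitivity (swd h (fun x c => swd x (fun a b => f1 a * f2 b * f3 c))).
  by apply: eq_sweedler => x c; rewrite sweedler_mulr.
rewrite sweedlerA; [|by move=> *; lin..].
apply: eq_sweedler => a y; rewrite sweedler_mull.
by apply: eq_sweedler => b c; rewrite mulrA.
Qed.
Fact conv_mul1l : left_id conv_one conv_mul.
Proof.
move=> f; apply: convP => h /=; rewrite -[RHS]sweedler_counitl; last exact: linearP.
by apply: eq_sweedler => a b; rewrite mulr_algl.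
Qed.
Fact conv_mul1r : right_id conv_one conv_mul.
Proof.
move=> f; apply: convP => h /=; rewrite -[RHS]sweedler_counitr; last exact: linearP.
by apply: eq_sweedler => a b; rewrite mulr_algr.
Qed.
Fact conv_mulDl : left_distributive conv_mul +%R.
Proof.
move=> f1 f2 f3; apply: convP => h; rewrite convD -sweedlerD.
by apply: eq_sweedler => a b; rewrite convD mulrDl.
Qed.
Fact conv_mulDr : right_distributive conv_mul +%R.
Proof.
move=> f1 f2 f3; apply: convP => h; rewrite convD -sweedlerD.
by apply: eq_sweedler => a b; rewrite convD mulrDr.
Qed.
Fact conv_one_neq0 : conv_one != 0.
Proof.
apply/eqP => /(congr1 (fun f : conv B => f 1)) /eqP.
by rewrite /= counit1 scale1r oner_eq0.
Qed.

HB.instance Definition _ := GRing.Zmodule_isNzRing.Build (conv B)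
  conv_mulA conv_mul1l conv_mul1r conv_mulDl conv_mulDr conv_one_neq0.

Lemma convM f f' h : (f * f') h = swd h (fun a b => f a * f' b).
Proof. by []. Qed.
Lemma conv1 h : (1 : conv B) h = (counit h)%:A.
Proof. by []. Qed.

Fact conv_scaleAl c f f' : c *: (f * f') = (c *: f) * f'.
Proof.
apply: convP => h; rewrite convZ !convM -sweedlerZ.
by apply: eq_sweedler => a b; rewrite convZ scalerAl.
Qed.
HB.instance Definition _ :=
  GRing.Lmodule_isLalgebra.Build K (conv B) conv_scaleAl.
Fact conv_scaleAr c f f' : c *: (f * f') = f * (c *: f').
Proof.
apply: convP => h; rewrite convZ !convM -sweedlerZ.
by apply: eq_sweedler => a b; rewrite convZ scalerAr.
Qed.
HB.instance Definition _ :=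
  GRing.Lalgebra_isAlgebra.Build K (conv B) conv_scaleAr.

Lemma sweedler_convE (F : H -> H -> conv B) h k :
  swd k F h = swd k (fun a b => F a b h).
Proof. exact: (@sweedler_comp K H _ _ F (fun f : conv B => f h)). Qed.

Fact translate_linear k f : linear (fun h => f (h * k)).
Proof. by lin. Qed.
Definition translate k f := to_conv (translate_linear k f).

Lemma translateE k f h : translate k f h = f (h * k). Proof. by []. Qed.

Fact translate_is_linear k : linear (translate k).
Proof. by move=> a f f'; apply: convP. Qed.
HB.instance Definition _ k :=
  GRing.isLinear.Build K (conv B) (conv B) _ (translate k) (@translate_is_linear k).

Lemma translate_linearl f : linear (translate^~ f).
Proof.
move=> a x y; apply: convP => h.
by rewrite convD convZ !translateE mulrDr -scalerAr linearP.
Qed.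

Lemma translate1 f : translate 1 f = f.
Proof. by apply: convP => h /=; rewrite mulr1. Qed.

Lemma translateA h k f : translate h (translate k f) = translate (h * k) f.
Proof. by apply: convP => x /=; rewrite mulrA. Qed.

(** Translation is an action of the Hopf algebra H on Hom(H, B) making it a
module algebra; grouplikes act by algebra automorphisms. *)
Lemma translate_mul k f f' :
  translate k (f * f') = swd k (fun a b => translate a f * translate b f').
Proof.
apply: convP => h; rewrite translateE sweedler_convE convM.
rewrite sweedlerM; [|by move=> *; lin..].
by rewrite exchange_sweedler; apply: eq_sweedler.
Qed.

Lemma translate_one k : translate k 1 = counit k *: (1 : conv B).
Proof.
apply: convP => h; rewrite translateE convZ !conv1 counitM.
by rewrite scalerA mulrC.
Qed.

Lemma conv_mul_grouplike f f' g : grouplike g -> (f * f') g = f g * f' g.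
Proof. by move=> gg; rewrite convM (sweedler_grouplike _ _ gg) // => ?; lin. Qed.

Lemma grouplike1 : grouplike (1 : H).
Proof. by split; [exact/eqP/oner_neq0|exact: comul1]. Qed.

Lemma grouplike_counit (g : H) : grouplike g -> counit g = 1.
Proof.
case=> g0 gg; have := counitl g; rewrite gg tensor_liftE => [|v a x y|u a x y].
2: by rewrite /= counit_is_scalar scalerDl scalerA.
2: by rewrite scalerDr !scalerA mulrC.
rewrite -[in RHS](scale1r g) => /eqP; rewrite -subr_eq0 -scalerBl scaler_eq0.
by case/orP=> [|/eqP//]; rewrite subr_eq0 => /eqP.
Qed.

Lemma translate_mulg g f f' : grouplike g ->
  translate g (f * f') = translate g f * translate g f'.
Proof.
move=> gg; rewrite translate_mul (sweedler_grouplike _ _ gg) // => ?.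
- by move=> a x y; rewrite translate_linearl mulrDl scalerAl.
- by move=> a x y; rewrite translate_linearl mulrDr scalerAr.
Qed.

Lemma translate_oneg g : grouplike g -> translate g (1 : conv B) = 1.
Proof. by move=> gg; rewrite translate_one grouplike_counit // scale1r. Qed.

(** The copy of the algebra B inside Hom(H, B). *)
Fact conv_cst_linear (b : B) : linear (fun h => counit h *: b).
Proof. by move=> a x y; rewrite counit_is_scalar scalerDl scalerA. Qed.
Definition conv_cst b := to_conv (conv_cst_linear b).

Lemma conv_cstMl b f h : (conv_cst b * f) h = b * f h.
Proof.
rewrite convM -(@sweedler_counitl _ _ _ (fun h => b * f h)); last by lin.
by apply: eq_sweedler => x y; rewrite /= scalerAl.
Qed.

Lemma conv_cstMr b f h : (f * conv_cst b) h = f h * b.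
Proof.
rewrite convM -(@sweedler_counitr _ _ _ (fun h => f h * b)); last by lin.
by apply: eq_sweedler => x y; rewrite /= scalerAr.
Qed.

End ConvAlgebra.
End Conv.

(** * The antipode is antimultiplicative *)

Section Antipode.
Variables (K : fieldType) (H : hopfAlgType K).
Implicit Types h k : H.
Local Notation swd := (@sweedler K H _).
Local Notation S := (@antipode K H).

HB.instance Definition _ :=
  GRing.isLinear.Build K H H _ (@antipode K H) (@antipode_is_linear K H).

Lemma antipode_l h : swd h (fun a b => S a * b) = (counit h)%:A.
Proof. exact: antipodel. Qed.
Lemma antipode_r h : swd h (fun a b => a * S b) = (counit h)%:A.
Proof. exact: antipoder. Qed.

(** An element of Hom(H, Hom(H, B)) is a bilinear map on H x H, and the iterated
convolution product is the one of the coalgebra H (x) H. *)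
Section Conv2.
Variables (B : lmodType K) (f : H -> H -> B).
Hypotheses (fl : forall k, linear (f^~ k)) (fr : forall h, linear (f h)).
Fact conv2_linear : linear (fun h => to_conv (fr h)).
Proof. by move=> a x y; apply: convP => k; rewrite convD convZ; apply: fl. Qed.
Definition conv2 : conv H (conv H B) := to_conv conv2_linear.
Lemma conv2E h k : conv2 h k = f h k. Proof. by []. Qed.
End Conv2.

Lemma conv2M (B : algType K) (F F' : conv H (conv H B)) h k :
  (F * F') h k = swd h (fun a b => swd k (fun c d => F a c * F' b d)).
Proof. by rewrite convM sweedler_convE; apply: eq_sweedler. Qed.

Lemma conv2_1 (B : algType K) h k :
  (1 : conv H (conv H B)) h k = (counit h * counit k)%:A.
Proof. by rewrite conv1 convZ conv1 scalerA. Qed.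

(** Both sides are convolution inverses of the multiplication of H, seen in
Hom(H, Hom(H, H)): the left side on the left, the right side on the right. *)
Lemma antipodeM h k : S (h * k) = S k * S h.
Proof.
pose F := @conv2 H (fun h k => S (h * k)) ltac:(by move=> ?; lin) ltac:(by move=> ?; lin).
pose M := @conv2 H (fun h k => h * k) ltac:(by move=> ?; lin) ltac:(by move=> ?; lin).
pose G := @conv2 H (fun h k => S k * S h) ltac:(by move=> ?; lin) ltac:(by move=> ?; lin).
have FM : F * M = 1.
  apply: convP => x; apply: convP => y; rewrite conv2M conv2_1 -counitM -antipode_l.
  by rewrite (@sweedlerM K H H (fun a b => S a * b)) // => ?; lin.
have MG : M * G = 1.
  apply: convP => x; apply: convP => y; rewrite conv2M conv2_1.
  transitivity (swd x (fun a b => counit y *: (a * S b))).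
    apply: eq_sweedler => a b.
    transitivity (a * swd y (fun c d => c * S d) * S b).
      rewrite sweedler_mull sweedler_mulr; apply: eq_sweedler => c d.
      by rewrite /M /G !conv2E !mulrA.
    by rewrite antipode_r -mulrA mulr_algl -scalerAr.
  by rewrite sweedlerZ antipode_r scalerA mulrC.
have FG : F = G by rewrite -[F]mulr1 -MG mulrA FM mul1r.
by have := congr1 (fun X : conv H (conv H H) => X h k) FG.
Qed.

Lemma antipode1 : S 1 = 1.
Proof.
have := antipode_l 1; rewrite sweedler1; [|by move=> ?; lin..].
by rewrite counit1 mulr1 scale1r.
Qed.

End Antipode.

(** * Relations between the ε_h *)

Section ParRelations.
Variables (K : fieldType) (H : hopfAlgType K).
Implicit Types h k : H.
Local Notation swd := (@sweedler K H _).
Local Notation S := (@antipode K H).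
Local Notation pi := (quot_alg_pi (AlgRels (@Hpar_proper K H))).

Fact brak_is_linear : linear (@brak K H).
Proof. by move=> a x y; rewrite /brak !linearP. Qed.
HB.instance Definition _ :=
  GRing.isLinear.Build K H (Hpar H) _ (@brak K H) brak_is_linear.

Lemma pi_sweedler h (f : H -> H -> tensor_alg H) :
  pi (swd h f) = swd h (fun a b => pi (f a b)).
Proof. by apply: sweedler_comp; apply: linearP. Qed.

Lemma brak1 : brak 1 = 1 :> Hpar H.
Proof.
apply: etrans (rmorph1 pi); apply/quot_alg_piP.
exact/gen_ideal_rel/Hpar_rel_unit.
Qed.

Lemma brak_eps h k :
  brak h * eps_Hpar k = swd k (fun a b => brak (h * a) * brak (S b)).
Proof.
rewrite /eps_Hpar sweedler_mull.
have /(@quot_alg_piP _ _ (AlgRels (@Hpar_proper K H))) :=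
  gen_ideal_rel (Hpar_rel_left h k).
rewrite !pi_sweedler => E; apply: etrans (etrans E _); apply: eq_sweedler => a b.
  by rewrite !rmorphM mulrA.
by rewrite !rmorphM.
Qed.

Lemma eps_brak h k :
  eps_Hpar h * brak k = swd h (fun a b => brak a * brak (S b * k)).
Proof.
rewrite /eps_Hpar sweedler_mulr.
have /(@quot_alg_piP _ _ (AlgRels (@Hpar_proper K H))) :=
  gen_ideal_rel (Hpar_rel_right h k).
by rewrite !pi_sweedler => E; apply: etrans (etrans E _); apply: eq_sweedler => a b;
  rewrite !rmorphM.
Qed.

Lemma eps_HparM h k :
  eps_Hpar (h * k) = swd h (fun a b => swd k (fun c d =>
    brak (a * c) * brak (S d * S b))).
Proof.
rewrite [LHS]sweedlerM; [|by move=> ?; lin..].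
by apply: eq_sweedler => a b; apply: eq_sweedler => c d; rewrite antipodeM.
Qed.

Definition brak_conv : conv H (Hpar H) := to_conv brak_is_linear.

Fact brak_antipode_linear : linear (fun h => brak (S h)).
Proof. by lin. Qed.
Definition brak_antipode : conv H (Hpar H) := to_conv brak_antipode_linear.

Definition eps_conv : conv H (Hpar H) := brak_conv * brak_antipode.

Lemma eps_convE h : eps_conv h = eps_Hpar h. Proof. by []. Qed.

(** [h_1][S(h_2)][h_3 k] = [h_1][S(h_2) h_3 k] = [h][k]. *)
Lemma sweedler_eps_brak h k :
  swd h (fun x y => eps_Hpar x * brak (y * k)) = brak h * brak k.
Proof.
under eq_sweedler do rewrite eps_brak.
rewrite (sweedlerA (f := fun a b y => brak a * brak (S b * (y * k)))); [|by move=> *; lin..].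
rewrite -(@sweedler_counitr _ _ _ (fun h => brak h * brak k)); last by lin.
apply: eq_sweedler => a z.
transitivity (brak a * brak (swd z (fun b y => S b * y) * k)).
  rewrite sweedler_mulr (sweedler_comp _ _ brak_is_linear) sweedler_mull.
  by apply: eq_sweedler => b y; rewrite mulrA.
by rewrite antipode_l mulr_algl linearZ /= -scalerAr.
Qed.

Lemma eps_conv_brak : eps_conv * brak_conv = brak_conv.
Proof.
apply: convP => h; rewrite convM -[RHS]mulr1 -brak1 -sweedler_eps_brak.
by apply: eq_sweedler => x y; rewrite mulr1.
Qed.

Lemma eps_conv_idem : eps_conv * eps_conv = eps_conv.
Proof. by rewrite {2}/eps_conv mulrA eps_conv_brak. Qed.

(** The rule ε_(h_1 k) [h_2] = [h] ε_k: the relation for [h_1][S(h_2)][k] lets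
S(h_2) cancel h_3, and the other one then splits off the factor [h]. *)
Lemma translate_eps_brak h k :
  (translate k eps_conv * brak_conv) h = brak h * eps_Hpar k.
Proof.
rewrite convM brak_eps.
transitivity (swd h (fun x y => swd x (fun a b => swd k (fun c d =>
    brak (a * c) * brak (S d * (S b * y)))))).
  apply: eq_sweedler => x y.
  rewrite translateE eps_convE eps_brak sweedlerM; [|by move=> ?; lin..].
  apply: eq_sweedler => a b; apply: eq_sweedler => c d.
  by rewrite antipodeM mulrA.
rewrite sweedlerA; [|by move=> *; apply: sweedler_linear_param => *; lin..].
rewrite -(@sweedler_counitr _ _ _
  (fun h => swd k (fun c d => brak (h * c) * brak (S d)))); last first.
  by apply: sweedler_linear_param => *; lin.
apply: eq_sweedler => a z; rewrite exchange_sweedler -sweedlerZ.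
apply: eq_sweedler => c d.
rewrite -sweedler_mull -(sweedler_comp _ _ brak_is_linear) -sweedler_mull.
by rewrite antipode_l mulr_algr linearZ /= -scalerAr.
Qed.

(** Both products take the value [h_1] ε_k [S(h_2)] at h. *)
Lemma translate_eps_comm k :
  translate k eps_conv * eps_conv = eps_conv * translate k eps_conv.
Proof.
apply: convP => h.
have -> : translate k eps_conv * eps_conv =
          translate k eps_conv * brak_conv * brak_antipode by rewrite -mulrA.
rewrite !convM.
transitivity (swd h (fun w v => swd w (fun x u => swd k (fun c d =>
   eps_Hpar x * brak (u * c) * brak (S d * S v))))).
  apply: eq_sweedler => w v; rewrite translate_eps_brak.
  rewrite -[LHS]mulrA [brak_antipode v]/(brak (S v)) eps_brak.
  rewrite exchange_sweedler sweedler_mull; apply: eq_sweedler => c d.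
  by rewrite -sweedler_mulr sweedler_eps_brak mulrA.
rewrite sweedlerA.
- apply: eq_sweedler => x y; rewrite translateE !eps_convE eps_HparM.
  rewrite sweedler_mull; apply: eq_sweedler => u v; rewrite sweedler_mull.
  by apply: eq_sweedler => c d; rewrite mulrA.
- move=> u v; apply: sweedler_linear_param => c d a x y.
  by rewrite -!eps_convE linearP !mulrDl !scalerAl.
- by move=> *; apply: sweedler_linear_param => *; lin.
- by move=> *; apply: sweedler_linear_param => *; lin.
Qed.

End ParRelations.

(** * Actions of algebras defined by generators and relations *)

Section Actions.
Variables (K : fieldType) (V : lmodType K) (F : V -> Prop).

(** The axioms are only asked on a subset [F] of [V]: for the action used
below, the unit of the algebra acts as a projection, and [F] is its range. *)
Record is_algebra_action (A : algType K) (act : A -> V -> V) : Prop := IsAction {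
  action_linear : forall f, F f -> linear (act^~ f);
  action0 : forall x, act x 0 = 0;
  action1 : forall f, F f -> act 1 f = f;
  actionM : forall x y f, F f -> act (x * y) f = act x (act y f);
  action_stable : forall x f, F f -> F (act x f)
}.

Lemma gen_ideal_action (A : algType K) (act : A -> V -> V) (R : A -> A -> Prop) :
  is_algebra_action act -> (forall x y, R x y -> forall f, F f -> act x f = act y f) ->
  forall x, gen_ideal R x -> forall f, F f -> act x f = 0.
Proof.
move=> actP actR x; elim=> {x} [x y Rxy||x y _ IHx _ IHy|a x _ IHx|a x _ IHx] f Ff.
- by rewrite (linear_ofB (action_linear actP Ff)) (actR _ _ Rxy) // subrr.
- exact: (linear_of0 (action_linear actP Ff)).
- have := action_linear actP Ff 1 x y.
  by rewrite !scale1r IHx // IHy // addr0.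
- by rewrite (actionM actP) // IHx // (action0 actP).
- by rewrite (actionM actP) // IHx //; apply: (action_stable actP).
Qed.

Definition quot_action (A : algType K) (R : alg_rels A) (act : A -> V -> V)
  (x : quot_alg R) := act (quot_alg_repr x).

Section QuotAction.
Variables (A : algType K) (R : alg_rels A) (act : A -> V -> V).
Hypothesis actP : is_algebra_action act.
Hypothesis actR : forall x y, R x y -> forall f, F f -> act x f = act y f.
Local Notation pi := (quot_alg_pi R).

Lemma quot_actionE x f : F f -> quot_action act (pi x) f = act x f.
Proof.
move=> Ff; apply/eqP; rewrite -subr_eq0 -(linear_ofB (action_linear actP Ff)).
apply/eqP/(gen_ideal_action actP actR) => //.
by apply/quot_alg_piP; rewrite quot_alg_reprK.
Qed.

Lemma quot_actionP : is_algebra_action (@quot_action A R act).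
Proof.
split=> [f Ff a x y|x|f Ff|x y f Ff|x f Ff].
- rewrite -[x]quot_alg_reprK -[y]quot_alg_reprK -linearP !quot_actionE //.
  exact: (action_linear actP).
- exact: (action0 actP).
- by rewrite -(rmorph1 pi) quot_actionE // (action1 actP).
- rewrite -[x]quot_alg_reprK -[y]quot_alg_reprK -rmorphM.
  rewrite !quot_actionE ?(actionM actP) //.
  exact: (action_stable actP).
- exact: (action_stable actP).
Qed.

End QuotAction.

Section FreeAction.
Variables (I : choiceType) (op : I -> V -> V).
Hypothesis opl : forall i, linear (op i).
Hypothesis opF : forall i f, F f -> F (op i f).
Hypothesis FD : forall a f f', F f -> F f' -> F (a *: f + f').
Hypothesis F0 : F 0.

Definition word_action (m : {fmonom I}) (f : V) : V := foldr op f (m : seq I).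

Definition free_action (x : free_alg K I) (f : V) : V :=
  \sum_(m <- msupp (x : {malg K[{fmonom I}]})) mcoeff m (x : {malg K[{fmonom I}]}) *: word_action m f.

Let actw (d : {fset {fmonom I}}) (x : {malg K[{fmonom I}]}) f :
  (msupp x `<=` d)%fset ->
  free_action x f = \sum_(m <- d) x@_m *: word_action m f.
Proof.
move=> le; rewrite /free_action [LHS](big_fset_incl _ le) => //= m _.
by move=> /mcoeff_outdom ->; rewrite scale0r.
Qed.

Lemma free_action_linear f : linear (free_action^~ f).
Proof.
move=> a r s.
pose d := (msupp (r : {malg _[_]}) `|` msupp (s : {malg _[_]})
           `|` msupp (a *: r + s : {malg _[_]}))%fset.
rewrite (@actw d r) ?(@actw d s) ?(@actw d (a *: r + s)).
- rewrite scaler_sumr -big_split /=; apply: eq_bigr => p _.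
  by rewrite mcoeffD mcoeffZ scalerDl scalerA.
- exact: fsubsetUr.
- by rewrite /d fsubsetU // fsubsetUr.
- by rewrite /d -fsetUA fsubsetUl.
Qed.

Lemma free_action_word m f : free_action << m >> f = word_action m f.
Proof.
rewrite /free_action msuppU oner_eq0 big_seq_fset1 mcoeffU eqxx.
by rewrite /= mulr1n scale1r.
Qed.

Lemma free_action_gen i f : free_action (free_gen K i) f = op i f.
Proof. by rewrite /free_gen free_action_word /word_action fmuE. Qed.

Lemma free_linear_ext (g g' : free_alg K I -> V) :
  linear g -> linear g' -> (forall m, g << m >> = g' << m >>) -> g =1 g'.
Proof.
move=> gl gl' E x.
have -> : x = \sum_(m <- msupp (x : {malg K[{fmonom I}]})) mcoeff m (x : {malg K[{fmonom I}]}) *: << m >>.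
  rewrite {1}[x](@monalgE {fmonom I}); apply: eq_bigr => m _.
  by apply/(@malgP {fmonom I}) => q; rewrite mcoeffZ !mcoeffU mulr_natr.
rewrite (linear_of_sum gl) (linear_of_sum gl'); apply: eq_bigr => m _.
by rewrite (linear_ofZ gl) (linear_ofZ gl') E.
Qed.

Lemma word_action_linear m : linear (word_action m).
Proof.
rewrite /word_action; elim: (m : seq I) => [|i s IHs] a x y //=.
by rewrite IHs opl.
Qed.

Lemma free_action_linearr x : linear (free_action x).
Proof.
move=> a f f'; rewrite /free_action scaler_sumr -big_split.
by apply: eq_bigr => m _; rewrite word_action_linear scalerDr !scalerA mulrC.
Qed.

Lemma free_actionP : is_algebra_action free_action.
Proof.
split=> [f _|x|f _|x y f _|x f Ff].
- exact: free_action_linear.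
- exact: (linear_of0 (free_action_linearr x)).
- by rewrite [LHS](free_action_word (fmone I)) /word_action fmoneE.
- move: x; apply: free_linear_ext => [a x x'|a x x'|m].
  + by rewrite mulrDl -scalerAl free_action_linear.
  + exact: free_action_linear.
  move: y; apply: free_linear_ext => [a y y'|a y y'|m'].
  + by rewrite mulrDr -scalerAr free_action_linear.
  + by rewrite free_action_linear free_action_linearr.
  rewrite -[_ * _]/(fgmul << m >> << m' >>) fgmulUU mulr1.
  by rewrite !free_action_word /word_action [mmul m m']fmmulE foldr_cat.
- rewrite /free_action; elim/big_rec: _ => [//|m g _ Fg]; apply: FD => //.
  rewrite /word_action; elim: (m : seq I) => [|i s IHs] //=.
  exact: opF.
Qed.

End FreeAction.
End Actions.

(** * Universality of A *)

Section AparUniversal.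
Variables (K : fieldType) (H : hopfAlgType K) (B : algType K).
Implicit Types h k : H.
Local Notation swd := (@sweedler K H _).
Local Notation S := (@antipode K H).
Local Notation T := (@translate K H B).
Implicit Types f p q : conv H B.

(** In a module algebra over H, Σ k_1 (p (S(k_2) q)) = (k p) q. *)
Lemma sweedler_translate_antipode k p q :
  swd k (fun a b => T a (p * T (S b) q)) = T k p * q.
Proof.
apply: convP => m; rewrite sweedler_convE convM.
transitivity (swd m (fun x y => swd k (fun a b => swd a (fun c d =>
    p (x * c) * q (y * d * S b))))).
  rewrite exchange_sweedler; apply: eq_sweedler => a b.
  rewrite translateE convM sweedlerM; [|by move=> ?; lin..].
  by rewrite exchange_sweedler.
apply: eq_sweedler => x y; rewrite sweedlerA; [|by move=> *; lin..].
rewrite -(@sweedler_counitr _ _ _ (fun k => T k p x * q y)); last first.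
  by move=> a h h'; rewrite translate_linearl convD convZ mulrDl scalerAl.
apply: eq_sweedler => c z.
transitivity (p (x * c) * q (y * swd z (fun d b => d * S b))).
  rewrite sweedler_mull (sweedler_comp _ _ (linearP q)) sweedler_mull.
  by apply: eq_sweedler => d b; rewrite mulrA.
by rewrite antipode_r mulr_algr linearZ /= -scalerAr.
Qed.

Local Notation tensor_rels := (AlgRels (@tensor_alg_proper K H)).
Local Notation Hpar_rels := (AlgRels (@Hpar_proper K H)).

Variable u : conv H B.
Hypothesis u_idem : u * u = u.
Hypothesis u_comm : forall k, T k u * u = u * T k u.
Hypothesis u_one : forall h, u 1 * u h = u h.

(** The projection f |-> u * f cuts Hom(H, B), on which H acts by translations,
down to its range; [compression h] is what remains of the action of h. *)
Definition compressed f : Prop := u * f = f.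
Definition compression h f : conv H B := u * T h f.

Local Notation F := compressed.
Local Notation op := compression.

Fact compression_linear h : linear (op h).
Proof. by move=> a f f'; rewrite /op linearP mulrDr scalerAr. Qed.

Fact compression_linearl f : linear (op^~ f).
Proof. by move=> a h h'; rewrite /op translate_linearl mulrDr scalerAr. Qed.

Fact compression_stable h f : F f -> F (op h f).
Proof. by rewrite /F /op mulrA u_idem. Qed.

Fact compressed_linear a f f' : F f -> F f' -> F (a *: f + f').
Proof. by rewrite /F mulrDr -scalerAr => -> ->. Qed.

Fact compressed0 : F 0.
Proof. exact: mulr0. Qed.

(** This is where ε_h acts by left multiplication. *)
Lemma compression_eps h f : F f ->
  swd h (fun a b => op a (op (S b) f)) = u * T h u * f.
Proof.
move=> Ff; rewrite -mulrA -sweedler_translate_antipode sweedler_mull.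
by apply: eq_sweedler.
Qed.

Definition tensor_action : tensor_alg H -> conv H B -> conv H B :=
  quot_action (free_action op).

Lemma tensor_alg_rel_action x y : tensor_alg_rel x y ->
  forall f, F f -> free_action op x f = free_action op y f.
Proof.
case=> a h h' f Ff; rewrite free_action_linear !free_action_gen.
exact: compression_linearl.
Qed.

Let freeP : is_algebra_action F (free_action op).
Proof.
exact: (free_actionP compression_linear compression_stable compressed_linear
          compressed0).
Qed.

Lemma tensor_actionP : is_algebra_action F tensor_action.
Proof. exact: (quot_actionP (R := tensor_rels) freeP tensor_alg_rel_action). Qed.

Lemma tensor_action_gen h f : F f -> tensor_action (tensor_gen h) f = op h f.
Proof.
move=> Ff; rewrite -(free_action_gen op).
exact: (quot_actionE (R := tensor_rels) freeP tensor_alg_rel_action).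
Qed.

Lemma tensor_action_gen2 h k f : F f ->
  tensor_action (tensor_gen h * tensor_gen k) f = op h (op k f).
Proof.
move=> Ff; rewrite (actionM tensor_actionP) // !tensor_action_gen //.
exact: compression_stable.
Qed.

Lemma tensor_action_gen3 h k l f : F f ->
  tensor_action (tensor_gen h * tensor_gen k * tensor_gen l) f =
  op h (op k (op l f)).
Proof.
move=> Ff; rewrite (actionM tensor_actionP) // tensor_action_gen //.
by rewrite tensor_action_gen2 //; apply: compression_stable.
Qed.

Lemma tensor_action_sweedler h (t : H -> H -> tensor_alg H) f : F f ->
  tensor_action (swd h t) f = swd h (fun a b => tensor_action (t a b) f).
Proof.
by move=> Ff; apply: (sweedler_comp _ _ (action_linear tensor_actionP Ff)).
Qed.

(** The compressions form a partial representation.  Both relations reduce, by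
[sweedler_translate_antipode], to the idempotency of [u] and to its commuting
with the translates of itself. *)
Lemma Hpar_rel_action x y : Hpar_rel x y ->
  forall f, F f -> tensor_action x f = tensor_action y f.
Proof.
case=> [|h k|h k] f Ff.
- rewrite tensor_action_gen // (action1 tensor_actionP) //.
  by rewrite /op translate1.
- rewrite [LHS](tensor_action_sweedler _ _ Ff) [RHS](tensor_action_sweedler _ _ Ff).
  transitivity (u * T h (u * (T k u * f))).
    rewrite -sweedler_translate_antipode sweedler_mull.
    rewrite (sweedler_comp _ _ (@translate_is_linear K H B h)) sweedler_mull.
    by apply: eq_sweedler => a b; rewrite tensor_action_gen3.
  rewrite [u * (_ * f)]mulrA -u_comm -(mulrA _ u) Ff -sweedler_translate_antipode.
  rewrite (sweedler_comp _ _ (@translate_is_linear K H B h)) sweedler_mull.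
  apply: eq_sweedler => a b; rewrite tensor_action_gen2 //.
  by rewrite /op translateA.
- rewrite [LHS](tensor_action_sweedler _ _ Ff) [RHS](tensor_action_sweedler _ _ Ff).
  transitivity (u * T h u * (u * T k f)).
    rewrite -compression_eps; last exact: compression_stable.
    by apply: eq_sweedler => a b; rewrite tensor_action_gen3.
  transitivity (u * (T h u * T k f)).
    by rewrite -u_comm mulrA -(mulrA _ u u) u_idem u_comm mulrA.
  rewrite -sweedler_translate_antipode sweedler_mull.
  apply: eq_sweedler => a b; rewrite tensor_action_gen2 //.
  by rewrite /op translateA.
Qed.

Definition Hpar_action : Hpar H -> conv H B -> conv H B := quot_action tensor_action.

Lemma Hpar_actionP : is_algebra_action F Hpar_action.
Proof. exact: (quot_actionP (R := Hpar_rels) tensor_actionP Hpar_rel_action). Qed.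

Lemma Hpar_action_brak h f : F f -> Hpar_action (brak h) f = op h f.
Proof.
move=> Ff; rewrite -tensor_action_gen //.
exact: (quot_actionE (R := Hpar_rels) tensor_actionP Hpar_rel_action).
Qed.

Lemma Hpar_action_eps h f : F f -> Hpar_action (eps_Hpar h) f = u * T h u * f.
Proof.
move=> Ff; rewrite -compression_eps //.
rewrite [LHS](sweedler_comp _ _ (action_linear Hpar_actionP Ff)).
apply: eq_sweedler => a b; rewrite (actionM Hpar_actionP) //.
by rewrite !Hpar_action_brak //; apply: compression_stable.
Qed.

Let g1 := @grouplike1 K H.

(** Elements of A act by left multiplications, so the value at 1 of the result
depends on [f] only through its value at 1; comparing with the case f = u gives
the multiplicativity of x |-> (x u)(1). *)
Lemma Hpar_action_value x f : in_Apar x -> F f ->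
  Hpar_action x f 1 = Hpar_action x u 1 * f 1.
Proof.
have aL := action_linear Hpar_actionP.
move=> Ax; elim: Ax f => {x} [h||a x y _ IHx _ IHy|x y _ IHx _ IHy] f Ff.
- rewrite !Hpar_action_eps // !(conv_mul_grouplike _ _ g1) translateE mul1r u_one.
  have := congr1 (fun f : conv H B => f 1) (u_comm h).
  by rewrite !(conv_mul_grouplike _ _ g1) translateE mul1r u_one => ->.
- rewrite !(action1 Hpar_actionP) //.
  by rewrite -[in LHS]Ff (conv_mul_grouplike _ _ g1).
- have E f' (Ff' : F f') : Hpar_action (a *: x + y) f' 1 =
      a *: Hpar_action x f' 1 + Hpar_action y f' 1.
    by have := congr1 (fun p : conv H B => p 1) (aL f' Ff' a x y).
  by rewrite [LHS](E f Ff) (E u u_idem) mulrDl -scalerAl (IHx f Ff) (IHy f Ff).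
- have aS := action_stable Hpar_actionP.
  have E f' (Ff' : F f') : Hpar_action (x * y) f' 1 =
      Hpar_action x u 1 * Hpar_action y f' 1.
    rewrite -(IHx _ (aS y f' Ff')).
    by have := congr1 (fun p : conv H B => p 1) (actionM Hpar_actionP x y Ff').
  by rewrite [LHS](E f Ff) (E u u_idem) (IHy f Ff) mulrA.
Qed.

Lemma Apar_universal : exists phi : {linear Apar H -> B},
  [/\ {morph phi : x y / x * y}, phi 1 = u 1 & forall h, phi (eps h) = u h].
Proof.
have Au (x : Apar H) : in_Apar (Apar_val x) by case: x => x /= /asboolP.
have aS := action_stable Hpar_actionP.
pose phi (x : Apar H) := Hpar_action (Apar_val x) u 1.
have phil : linear phi.
  by move=> a x y; rewrite /phi /= (action_linear Hpar_actionP).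
exists (linear_of phil); split=> [x y||h] /=.
- by rewrite /phi /= (actionM Hpar_actionP) // Hpar_action_value //; apply: aS.
- by rewrite /phi /= (action1 Hpar_actionP).
- rewrite /phi /= Hpar_action_eps // !(conv_mul_grouplike _ _ g1) translateE.
  have := congr1 (fun f : conv H B => f 1) (u_comm h).
  by rewrite !(conv_mul_grouplike _ _ g1) translateE mul1r u_one.
Qed.

End AparUniversal.

(** * Subspaces and functionals *)

Section LinearAlgebra.
Variables (K : fieldType) (V : lmodType K).
Implicit Types (W M : V -> Prop) (s : seq V).

Definition is_subspace W : Prop := W 0 /\ forall a x y, W x -> W y -> W (a *: x + y).

Section Subspace.
Variable W : V -> Prop.
Hypothesis sW : is_subspace W.

Lemma subspaceZ a x : W x -> W (a *: x).
Proof. by move=> Wx; rewrite -[_ *: _]addr0; apply: sW.2 => //; apply: sW.1. Qed.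

Lemma subspaceD x y : W x -> W y -> W (x + y).
Proof. by move=> Wx Wy; rewrite -[x]scale1r; apply: sW.2. Qed.

Lemma subspaceB x y : W x -> W y -> W (x - y).
Proof. by move=> Wx Wy; rewrite addrC -scaleN1r; apply: sW.2. Qed.

Lemma subspace_sum (I : eqType) (r : seq I) E :
  (forall i, i \in r -> W (E i)) -> W (\sum_(i <- r) E i).
Proof.
move=> WE; rewrite big_seq; elim/big_rec: _ => [|i x ri Wx]; first exact: sW.1.
by apply: subspaceD => //; apply: WE.
Qed.

End Subspace.

(** By Zorn, W extends to a subspace M maximal among those avoiding x; then M is
a complement of the line spanned by x, and phi is the coordinate along x. *)
Lemma exists_functional W x : is_subspace W -> ~ W x ->
  exists phi : V -> K^o, [/\ linear phi, forall w, W w -> phi w = 0 & phi x = 1].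
Proof.
move=> sW nWx.
pose P (A : V -> Prop) := is_subspace (fun y => A y \/ W y) /\ ~ A x.
have [F FP Ftot|A [[sM nAx] Amax]] := @classical_sets.Zorn_bigcup V P.
  (* W is adjoined by hand in P: the union of the empty chain is empty. *)
  split; last by case=> X FX Xx; case: (FP X FX).
  have FW X y z a : F X -> X y \/ W y -> X z \/ W z ->
      classical_sets.bigcup F id (a *: y + z) \/ W (a *: y + z).
    move=> FX Xy Xz; case: (FP X FX) => [[_ sX] _].
    by case: (sX a y z Xy Xz) => [?|]; [left; exists X|right].
  split; first by right; exact: sW.1.
  move=> a y z [[X FX Xy]|Wy] [[Y FY Yz]|Wz].
  - case: (Ftot X Y FX FY) => XY; [apply: (FW Y)|apply: (FW X)] => //; left => //.
      exact: XY.
    exact: XY.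
  - by apply: (FW X) => //; [left|right].
  - by apply: (FW Y) => //; [right|left].
  - by right; apply: sW.2.
pose M y := A y \/ W y.
have nMx : ~ M x by case.
have coord y : exists a, M (y - a *: x).
  apply: contrapT => nex.
  pose B z := exists a, M (z - a *: y).
  have MB z : M z -> B z by exists 0; rewrite scale0r subr0.
  have By : B y by exists 1; rewrite scale1r subrr; exact: sM.1.
  have nMy : ~ M y by move=> My; apply: nex; exists 0; rewrite scale0r subr0.
  apply: (Amax B).
    split; first by move=> z Az; apply: MB; left.
    by move=> BA; apply: nMy; left; apply: BA.
  split; last first.
    case=> a Ma; have [a0|a0] := eqVneq a 0.
      by apply: nMx; move: Ma; rewrite a0 scale0r subr0.
    apply: nex; exists a^-1.
    have -> : y - a^-1 *: x = - a^-1 *: (x - a *: y).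
      by rewrite scalerBr !scaleNr scalerA mulVf // scale1r opprK addrC.
    exact: (subspaceZ sM).
  split; first by right; exact: sW.1.
  move=> a z z' Bz Bz'; left.
  have BB u : B u \/ W u -> B u by case=> // Wu; apply: MB; right.
  case: (BB _ Bz) => b Mb; case: (BB _ Bz') => b' Mb'.
  exists (a * b + b').
  have -> : a *: z + z' - (a * b + b') *: y = a *: (z - b *: y) + (z' - b' *: y).
    by rewrite scalerBr scalerDl scalerA opprD addrACA.
  exact: sM.2.
have uniq y a b : M (y - a *: x) -> M (y - b *: x) -> a = b.
  move=> Ma Mb; apply/eqP; rewrite -subr_eq0; apply: contrapT => /negP ab.
  apply: nMx; have -> : x = (a - b)^-1 *: ((y - b *: x) - (y - a *: x)).
    by rewrite opprB [X in _ *: X]addrC addrA subrK -scalerBl scalerA mulVf // scale1r.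
  by apply: (subspaceZ sM); apply: (subspaceB sM).
pose phi y : K^o := sval (cid (coord y)).
have phiP y : M (y - phi y *: x) := svalP (cid (coord y)).
exists phi; split.
- move=> a y z; apply: (uniq (a *: y + z)); first exact: phiP.
  rewrite scalerDl -[a *: phi y]/(a * phi y) -scalerA opprD addrACA -scalerBr.
  by apply: sM.2; apply: phiP.
- move=> w Ww; apply: (uniq w); first exact: phiP.
  by rewrite scale0r subr0; right.
- apply: (uniq x); first exact: phiP.
  by rewrite scale1r subrr; exact: sM.1.
Qed.

Fixpoint lspan s x : Prop :=
  if s is v :: s' then exists a : K, lspan s' (x - a *: v) else x = 0.

Lemma lspan_subspace s : is_subspace (lspan s).
Proof.
elim: s => [|v s [s0 IHs]] /=.
  by split=> // a x y -> ->; rewrite scaler0 addr0.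
split; first by exists 0; rewrite scale0r subr0.
move=> a x y [b xb] [c yc]; exists (a * b + c).
have -> : a *: x + y - (a * b + c) *: v = a *: (x - b *: v) + (y - c *: v).
  by rewrite scalerBr scalerDl scalerA opprD addrACA.
exact: IHs.
Qed.

Lemma lspan_cat s s' x y : lspan s x -> lspan s' y -> lspan (s ++ s') (x + y).
Proof.
elim: s x => [|v s IHs] x /=; first by move=> ->; rewrite add0r.
by move=> [a xa] s'y; exists a; rewrite addrAC; apply: IHs.
Qed.

Lemma lspan_sum (I : Type) (r : seq I) (c : I -> K) (v : I -> V) :
  lspan [seq v i | i <- r] (\sum_(i <- r) c i *: v i).
Proof.
elim: r => [|i r IHr]; first by rewrite big_nil.
by exists (c i); rewrite big_cons addrC addKr.
Qed.

Lemma mem_lspan s v : v \in s -> lspan s v.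
Proof.
elim: s => [//|w s IHs]; rewrite inE => /orP[/eqP->|/IHs sv].
  by exists 1; rewrite scale1r subrr; exact: (lspan_subspace s).1.
by exists 0; rewrite scale0r subr0.
Qed.

(** Gaussian elimination: a spanning vector on which phi does not vanish can be
spared for the kernel of phi. *)
Lemma lspan_ker s (phi : V -> K^o) x0 : linear phi -> lspan s x0 -> phi x0 != 0 ->
  exists s', (size s' < size s)%N /\ forall x, lspan s x -> phi x = 0 -> lspan s' x.
Proof.
move=> phil; elim: s x0 => [|v s IHs] x0 /=.
  by move=> ->; rewrite (linear_of0 phil) eqxx.
case=> a0 sx0 px0; have [pv|pv] := eqVneq (phi v) 0.
  have phiE a x : phi (x - a *: v) = phi x.
    by rewrite (linear_ofB phil) (linear_ofZ phil) pv scaler0 subr0.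
  have [|s' [ss' s'P]] := IHs _ sx0; first by rewrite phiE.
  exists (v :: s'); split=> // x [a xa] px; exists a; apply: s'P => //.
  by rewrite phiE.
pose pr w := w - (phi w / phi v) *: v.
have prl : linear pr.
  move=> a x y; rewrite /pr phil mulrDl scalerDl scalerBr scalerA.
  by rewrite -[a *: phi x]/(a * phi x) -mulrA opprD addrACA.
exists [seq pr w | w <- s]; split=> [|x [a xa] px]; first by rewrite size_map.
have -> : x = pr (x - a *: v).
  rewrite (linear_ofB prl) (linear_ofZ prl) {1}/pr px mul0r scale0r subr0.
  by rewrite /pr divff // scale1r subrr scaler0 subr0.
elim: (s) (x - a *: v) xa => [|w r IHr] y /=; first by move=> ->; exact: (linear_of0 prl).
by case=> b /IHr; exists b; rewrite -(linear_ofZ prl) -(linear_ofB prl).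
Qed.

(** W is minimal among the subspaces strictly containing M on which [Inv] holds:
for invariance conditions, W / M is a simple submodule. *)
Definition minimal_over (Inv : (V -> Prop) -> Prop) M W : Prop :=
  [/\ Inv W, is_subspace W, forall x, M x -> W x, (exists2 x, W x & ~ M x) &
      forall W', Inv W' -> is_subspace W' -> (forall x, M x -> W' x) ->
        (forall x, W' x -> W x) -> (exists2 x, W' x & ~ M x) ->
        forall x, W x -> W' x].

(** Descending induction on the number of vectors which span W0 modulo M. *)
Lemma exists_minimal_over (Inv : (V -> Prop) -> Prop) M W0 s :
  Inv W0 -> is_subspace W0 -> (forall x, M x -> W0 x) -> (exists2 x, W0 x & ~ M x) ->
  (forall x, W0 x -> exists2 y, lspan s y & M (x - y)) ->
  exists2 W, minimal_over Inv M W & forall x, W x -> W0 x.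
Proof.
have [n] := ubnP (size s); elim: n W0 s => // n IHn W0 s ltsn I0 s0 M0 ex0 W0s.
case: (pselect (minimal_over Inv M W0)) => [|nmin]; first by exists W0.
have [W' [[I' s'] M' W'0 ex' [x W0x nW'x]]] : exists W', [/\ Inv W' /\ is_subspace W',
    forall x, M x -> W' x, forall x, W' x -> W0 x, (exists2 x, W' x & ~ M x) &
    (exists2 x, W0 x & ~ W' x)].
  apply: contrapT => nex; apply: nmin; split=> // W' I' s' M' W'0 ex' x W0x.
  by apply: contrapT => nW'x; apply: nex; exists W'; split=> //; exists x.
have [phi [phil phi0 phi1]] := exists_functional s' nW'x.
have [y sy Mxy] := W0s x W0x.
have phiM z w : M (z - w) -> phi w = phi z.
  move=> /M'/phi0/eqP; rewrite (linear_ofB phil) subr_eq0 => /eqP->.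
  by [].
have [|s'' [lts s''P]] := lspan_ker phil sy.
  by rewrite (phiM _ _ Mxy) phi1 oner_eq0.
have [||W minW WW'] := IHn W' s'' _ I' s' M' ex'.
- exact: leq_trans lts _.
- move=> z W'z; have [w sw Mzw] := W0s z (W'0 z W'z).
  by exists w => //; apply: s''P => //; rewrite (phiM _ _ Mzw) phi0.
by exists W => // z /WW' /W'0.
Qed.

End LinearAlgebra.

(** * Membership of tensors in a product of subspaces *)

Section TensorSubspace.
Variables (K : fieldType) (U V : lmodType K).
Implicit Types (s : seq (U * V)) (t : tensor U V).
Local Notation tsum s := (\sum_(p <- s) p.1 \ox p.2 : tensor U V).

Lemma tens_span_snd s a b : lspan [seq p.2 | p <- s] b ->
  exists2 s', size s' = size s & a \ox b + tsum s = tsum s'.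
Proof.
elim: s b => [|[a1 b1] s IHs] b /=.
  by move=> ->; exists [::]; rewrite // (linear_of0 (@tens_linearr K U V a)) add0r.
case=> c /IHs[s' <- E]; exists ((c *: a + a1, b1) :: s') => //.
rewrite !big_cons -E /= tens_linearl (linear_ofB (@tens_linearr K U V a)).
rewrite (linear_ofZ (@tens_linearr K U V a)).
by rewrite [RHS]addrACA; congr (_ + _); rewrite addrCA subrr addr0.
Qed.

Lemma tens_span_fst s a b : lspan [seq p.1 | p <- s] a ->
  exists2 s', size s' = size s & a \ox b + tsum s = tsum s'.
Proof.
elim: s a => [|[a1 b1] s IHs] a /=.
  by move=> ->; exists [::]; rewrite // (linear_of0 (@tens_linearl K U V b)) add0r.
case=> c /IHs[s' <- E]; exists ((a1, c *: b + b1) :: s') => //.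
rewrite !big_cons -E /= tens_linearr (linear_ofB (@tens_linearl K U V b)).
rewrite (linear_ofZ (@tens_linearl K U V b)).
by rewrite [RHS]addrACA; congr (_ + _); rewrite addrCA subrr addr0.
Qed.

(** In a shortest expression of t, no first (or second) component lies in the span
of the others: it could be eliminated. *)
Lemma tensor_sum_free t : exists2 s, t = tsum s & forall p, p \in s ->
  ~ lspan [seq q.1 | q <- rem p s] p.1 /\ ~ lspan [seq q.2 | q <- rem p s] p.2.
Proof.
have [s0 Es0] := tensor_sum t.
have [n] := ubnP (size s0); elim: n s0 Es0 => // n IHn s Es ltsn.
have [free|nfree] := pselect (forall p, p \in s ->
  ~ lspan [seq q.1 | q <- rem p s] p.1 /\ ~ lspan [seq q.2 | q <- rem p s] p.2).
  by exists s.
have [p ps dep] : exists2 p, p \in s &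
    lspan [seq q.1 | q <- rem p s] p.1 \/ lspan [seq q.2 | q <- rem p s] p.2.
  apply: contrapT => nex; apply: nfree => p ps; split=> dep; apply: nex.
    by exists p => //; left.
  by exists p => //; right.
have lt_rem : (size (rem p s) < n)%N.
  by rewrite size_rem //; case: (s) ps ltsn => //= ? ?.
have Et : t = p.1 \ox p.2 + tsum (rem p s).
  by rewrite Es (perm_big _ (perm_to_rem ps)) big_cons.
have [s' szs' Es'] : exists2 s', size s' = size (rem p s) & t = tsum s'.
  case: dep => dep.
    by have [s' ? E] := tens_span_fst p.2 dep; exists s'; rewrite // Et E.
  by have [s' ? E] := tens_span_snd p.1 dep; exists s'; rewrite // Et E.
by apply: (IHn s') => //; rewrite szs'.
Qed.

(** Contracting a shortest expression of t with a functional equal to 1 on one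
component and vanishing on the others isolates the factor of that component. *)
Lemma tensor_subspace t (M : U -> Prop) (N : V -> Prop) :
  is_subspace M -> is_subspace N ->
  (forall chi : V -> K^o, linear chi -> M (tensor_lift (fun a b => chi b *: a) t)) ->
  (forall phi : U -> K^o, linear phi -> N (tensor_lift (fun a b => phi a *: b) t)) ->
  exists2 s, t = tsum s & forall p, p \in s -> M p.1 /\ N p.2.
Proof.
move=> sM sN tM tN; have [s Es free] := tensor_sum_free t.
exists s => // p ps; have [free1 free2] := free p ps; split.
- have [chi [chil chi0 chi1]] := exists_functional (lspan_subspace _) free2.
  have := tM chi chil; rewrite Es tensor_lift_sum => [|v a x y|u a x y].
  + rewrite (perm_big _ (perm_to_rem ps)) big_cons /= chi1 scale1r big_seq big1 ?addr0 //.
    move=> q qs; rewrite chi0 ?scale0r //; apply: mem_lspan.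
    by apply/mapP; exists q.
  + by rewrite scalerDr !scalerA mulrC.
  + by rewrite chil scalerDl scalerA.
- have [chi [chil chi0 chi1]] := exists_functional (lspan_subspace _) free1.
  have := tN chi chil; rewrite Es tensor_lift_sum => [|v a x y|u a x y].
  + rewrite (perm_big _ (perm_to_rem ps)) big_cons /= chi1 scale1r big_seq big1 ?addr0 //.
    move=> q qs; rewrite chi0 ?scale0r //; apply: mem_lspan.
    by apply/mapP; exists q.
  + by rewrite chil scalerDl scalerA.
  + by rewrite scalerDr !scalerA mulrC.
Qed.

End TensorSubspace.

(** * The dual algebra acting on H, and pointedness *)

Section Pointed.
Variables (K : fieldType) (H : hopfAlgType K).
Implicit Types (h : H) (M W C : H -> Prop).
Local Notation swd := (@sweedler K H _).
Local Notation dual := (conv H K^o).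
Implicit Types phi chi psi : dual.

(** The two hit actions of the dual algebra H^* on H.  Through them, subcoalgebras
and coideals of H become plain invariant subspaces. *)
Definition lhit phi h : H := swd h (fun a b => (phi a : K) *: b).
Definition rhit chi h : H := swd h (fun a b => (chi b : K) *: a).

Fact scale_linearl (U W : lmodType K) (f : U -> K^o) (w : W) :
  linear f -> linear (fun u => (f u : K) *: w).
Proof. by move=> fl a x y; rewrite fl scalerDl scalerA. Qed.

Fact scale_linearr (W : lmodType K) (c : K) : linear (fun w : W => c *: w).
Proof. by move=> a x y; rewrite scalerDr !scalerA mulrC. Qed.

Lemma lhit_linear phi : linear (lhit phi).
Proof.
by apply: sweedler_linear => [v|u]; [apply: scale_linearl; apply: linearP|apply: scale_linearr].
Qed.

Lemma rhit_linear chi : linear (rhit chi).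
Proof.
by apply: sweedler_linear => [v|u]; [apply: scale_linearr|apply: scale_linearl; apply: linearP].
Qed.

Lemma rhit_linearl h : linear (rhit^~ h).
Proof.
apply: sweedler_linear_param => a b.
by apply: (@scale_linearl dual _ (fun phi : dual => phi b)).
Qed.

Lemma lhit_rhit phi chi h : lhit phi (rhit chi h) = rhit chi (lhit phi h).
Proof.
rewrite [rhit chi h]/rhit (sweedler_comp _ _ (lhit_linear phi)).
rewrite [lhit phi h]/lhit (sweedler_comp _ _ (rhit_linear chi)).
transitivity (swd h (fun x c => swd x (fun a b => (phi a * chi c : K) *: b))).
  apply: eq_sweedler => x c; rewrite (linear_ofZ (lhit_linear phi)) -sweedlerZ.
  by apply: eq_sweedler => a b; rewrite scalerA mulrC.
rewrite sweedlerA => [|b c|a c|a b].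
- apply: eq_sweedler => a y; rewrite (linear_ofZ (rhit_linear chi)) -sweedlerZ.
  by apply: eq_sweedler => b c; rewrite scalerA.
- by apply: scale_linearl; lin.
- exact: scale_linearr.
- by apply: scale_linearl; lin.
Qed.

Lemma lhitM phi psi h : lhit phi (lhit psi h) = lhit (psi * phi) h.
Proof.
rewrite [lhit psi h]/lhit (sweedler_comp _ _ (lhit_linear phi)).
transitivity (swd h (fun x c => swd x (fun a b => (psi a * phi b : K) *: c))).
  rewrite sweedlerA => [|b c|a c|a b].
  - apply: eq_sweedler => a y; rewrite (linear_ofZ (lhit_linear phi)) -sweedlerZ.
    by apply: eq_sweedler => b c; rewrite scalerA.
  - by apply: scale_linearl; lin.
  - by apply: scale_linearl; lin.
  - exact: scale_linearr.
apply: eq_sweedler => x c; rewrite convM.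
by rewrite [RHS](sweedler_comp _ _ (@scale_linearl K^o _ id c _)).
Qed.

Lemma rhitM chi psi h : rhit chi (rhit psi h) = rhit (chi * psi) h.
Proof.
rewrite [rhit psi h]/rhit (sweedler_comp _ _ (rhit_linear chi)).
transitivity (swd h (fun a y => swd y (fun b c => (chi b * psi c : K) *: a))).
  rewrite -sweedlerA => [|b c|a c|a b].
  - apply: eq_sweedler => x c; rewrite (linear_ofZ (rhit_linear chi)) -sweedlerZ.
    by apply: eq_sweedler => a b; rewrite scalerA mulrC.
  - exact: scale_linearr.
  - by apply: scale_linearl; lin.
  - by apply: scale_linearl; lin.
apply: eq_sweedler => a y; rewrite convM.
by rewrite [RHS](sweedler_comp _ _ (@scale_linearl K^o _ id a _)).
Qed.

Lemma dual1 h : (1 : dual) h = counit h.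
Proof. by rewrite conv1 -[_%:A]/(counit h * 1) mulr1. Qed.

Lemma lhit1 h : lhit 1 h = h.
Proof.
rewrite -[RHS](@sweedler_counitl _ _ _ id) //.
by apply: eq_sweedler => a b; rewrite dual1.
Qed.

Lemma rhit1 h : rhit 1 h = h.
Proof.
rewrite -[RHS](@sweedler_counitr _ _ _ id) //.
by apply: eq_sweedler => a b; rewrite dual1.
Qed.

Lemma counit_lhit phi h : counit (lhit phi h) = phi h.
Proof.
have cl : linear (counit : H -> K^o) by move=> a x y; rewrite counit_is_scalar.
rewrite -[in RHS](mulr1 phi) convM [LHS](sweedler_comp _ _ cl).
by apply: (@eq_sweedler K H K^o) => a b; rewrite dual1 [LHS](linear_ofZ cl).
Qed.

Lemma lhit_lspan h : exists s, forall phi, lspan s (lhit phi h).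
Proof.
have [s Es] := tensor_sum (comul h); exists [seq p.2 | p <- s] => phi.
rewrite /lhit (sweedler_sum _ _ Es) => [|v|u]; first exact: lspan_sum.
  by apply: scale_linearl; apply: linearP.
exact: scale_linearr.
Qed.

Lemma rhit_lspan h : exists s, forall chi, lspan s (rhit chi h).
Proof.
have [s Es] := tensor_sum (comul h); exists [seq p.1 | p <- s] => chi.
rewrite /rhit (sweedler_sum _ _ Es) => [|v|u]; first exact: lspan_sum.
  exact: scale_linearr.
by apply: scale_linearl; apply: linearP.
Qed.

Lemma lhit_lspan_lspan s :
  exists s', forall phi x, lspan s x -> lspan s' (lhit phi x).
Proof.
elim: s => [|v s [s1 s1P]].
  by exists [::] => phi x /= ->; exact: (linear_of0 (lhit_linear phi)).
have [s2 s2P] := lhit_lspan v.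
exists (s1 ++ s2) => phi x [a xa].
have -> : lhit phi x = lhit phi (x - a *: v) + a *: lhit phi v.
  by rewrite (linear_ofB (lhit_linear phi)) (linear_ofZ (lhit_linear phi)) subrK.
by apply: lspan_cat; [exact: s1P|apply: (subspaceZ (lspan_subspace _))].
Qed.

Definition right_coideal W := forall chi x, W x -> W (rhit chi x).
Definition left_coideal W := forall phi x, W x -> W (lhit phi x).

(** Invariant subspaces are subcoalgebras by [tensor_subspace]. *)
Lemma coideals_subcoalgebra C :
  is_subspace C -> left_coideal C -> right_coideal C -> subcoalgebra C.
Proof.
move=> sC lC rC; split=> // c Cc.
have [||s Es sP] := tensor_subspace sC sC (t := comul c).
- by move=> chi chil; apply: (rC (to_conv chil)).
- by move=> phi phil; apply: (lC (to_conv phil)).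
by exists s.
Qed.

Lemma subcoalgebra_left C : subcoalgebra C -> left_coideal C.
Proof.
case=> sC CC phi c Cc; have [s [sP Es]] := CC c Cc.
rewrite /lhit (sweedler_sum _ _ Es) => [|v|u].
- by apply: (subspace_sum sC) => p /sP[_ ?]; apply: (subspaceZ sC).
- by apply: scale_linearl; apply: linearP.
- exact: scale_linearr.
Qed.

Lemma subcoalgebra_right C : subcoalgebra C -> right_coideal C.
Proof.
case=> sC CC chi c Cc; have [s [sP Es]] := CC c Cc.
rewrite /rhit (sweedler_sum _ _ Es) => [|v|u].
- by apply: (subspace_sum sC) => p /sP[? _]; apply: (subspaceZ sC).
- exact: scale_linearr.
- by apply: scale_linearl; apply: linearP.
Qed.

(** If Δ(c) = b (c (x) c), the counit forces b to be nonzero, and b c is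
grouplike. *)
Lemma one_dimensional_grouplike C : subcoalgebra C -> one_dimensional C ->
  exists2 g, grouplike g & C g.
Proof.
case=> sC CC [c c0 Cc]; have Ccc : C c by apply/Cc; exists 1; rewrite scale1r.
have [s [sP Es]] := CC c Ccc.
have [b Eb] : exists b, comul c = b *: (c \ox c).
  rewrite Es big_seq.
  elim/big_rec: _ => [|p t ps [b ->]]; first by exists 0; rewrite scale0r.
  have [/Cc[a1 ->] /Cc[a2 ->]] := sP p ps; exists (a2 * a1 + b).
  rewrite (linear_ofZ (@tens_linearl _ H H _)) (linear_ofZ (@tens_linearr _ H H _)).
  by rewrite scalerDl scalerA mulrC.
have b0 : b != 0.
  apply/eqP => b0; apply: c0; rewrite -(lhit1 c) /lhit /sweedler Eb b0 scale0r.
  apply: linear_of0; apply: tensor_lift_linear => *.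
    by apply: scale_linearl; apply: linearP.
  exact: scale_linearr.
exists (b *: c); last by apply/Cc; exists b.
split.
  by move/eqP; rewrite scaler_eq0 (negbTE b0) => /eqP.
rewrite (linear_ofZ (@comul_is_linear K H)) Eb.
by rewrite (linear_ofZ (@tens_linearl _ H H _)) (linear_ofZ (@tens_linearr _ H H _)).
Qed.

Lemma rhit_grouplike chi g : grouplike g -> rhit chi g = (chi g : K) *: g.
Proof.
move=> gg; rewrite /rhit (sweedler_grouplike _ _ gg) // => *.
  exact: scale_linearr.
by apply: scale_linearl; apply: linearP.
Qed.

(** As Δ(M) is contained in M (x) H, functionals vanishing on M kill M. *)
Lemma right_coideal_kills M (phi : dual) x : is_subspace M -> right_coideal M ->
  (forall m, M m -> phi m = 0) -> M x -> lhit phi x = 0.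
Proof.
move=> sM rM phiM Mx.
have [|||s Es sP] := @tensor_subspace K H H (comul x) M (fun=> True) sM.
- by [].
- by move=> chi chil; apply: (rM (to_conv chil)).
- by [].
rewrite /lhit (sweedler_sum _ _ Es) => [|v|u].
- by rewrite big_seq big1 // => p /sP[/phiM-> _]; rewrite scale0r.
- by apply: scale_linearl; apply: linearP.
- exact: scale_linearr.
Qed.

End Pointed.

(** * Rigidity of idempotents *)

Section Rigidity.
Variables (K : fieldType) (H : hopfAlgType K).
Implicit Types (h x : H) (M W C : H -> Prop).
Local Notation dual := (conv H K^o).
Implicit Types phi chi psi : dual.

(** A minimal invariant subspace of C is a simple subcoalgebra, hence a line
spanned by a grouplike. *)
Lemma pointed_grouplike_in (H_pointed : pointed H) C s :
  is_subspace C -> left_coideal C -> right_coideal C -> (exists2 x, C x & x <> 0) ->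
  (forall x, C x -> lspan s x) -> exists2 g, grouplike g & C g.
Proof.
move=> sC lC rC ex Cs.
pose Inv (W : H -> Prop) := left_coideal W /\ right_coideal W.
have [|||||D [[lD rD] sD D0 exD minD] DC] := @exists_minimal_over K H Inv
    (fun x => x = 0) C s.
- by [].
- by [].
- by move=> x ->; exact: sC.1.
- by [].
- by move=> x /Cs sx; exists x; rewrite ?subrr.
have sub := coideals_subcoalgebra sD lD rD.
have [|g gg Dg] := one_dimensional_grouplike sub; last by exists g => //; apply: DC.
apply: H_pointed; split=> // E subE ED.
case: (pselect (exists2 x, E x & x <> 0)) => [exE|nexE].
  right; apply: minD => //.
  - by split; [exact: subcoalgebra_left|exact: subcoalgebra_right].
  - by case: subE.
  - by move=> x ->; exact: subE.1.1.
by left=> x Ex; apply: contrapT => x0; apply: nexE; exists x.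
Qed.

(** In this section, W / M is a simple right H-comodule contained in H / M.  The
functionals vanishing on M map it to H; the images span a subcoalgebra
([coefficients]), which contains some grouplike g since H is pointed.  That
subcoalgebra is a sum of copies of W / M, so W / M must be the one-dimensional
comodule given by g. *)
Section Skew.
Variable M : H -> Prop.
Hypotheses (sM : is_subspace M) (rM : right_coideal M).

Definition generated_over x y : Prop := exists chi, M (y - rhit chi x).

Lemma generated_over_subspace x : is_subspace (generated_over x).
Proof.
have rl := linear_of0 (rhit_linearl x).
split; first by exists 0; rewrite rl subr0; exact: sM.1.
move=> a y z [chi My] [psi Mz]; exists (a *: chi + psi).
have -> : a *: y + z - rhit (a *: chi + psi) x =
          a *: (y - rhit chi x) + (z - rhit psi x).
  by rewrite (rhit_linearl x) scalerBr opprD addrACA.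
exact: sM.2.
Qed.

Lemma generated_over_coideal x : right_coideal (generated_over x).
Proof.
move=> psi y [chi My]; exists (psi * chi).
by rewrite -rhitM -(linear_ofB (rhit_linear psi)); apply: rM.
Qed.

Lemma generated_over_sub x y : M y -> generated_over x y.
Proof. by move=> My; exists 0; rewrite (linear_of0 (rhit_linearl x)) subr0. Qed.

Lemma generated_over_mem x : generated_over x x.
Proof. by exists 1; rewrite rhit1 subrr; exact: sM.1. Qed.

Lemma exists_simple_over : (exists x, ~ M x) ->
  exists x0 W, minimal_over (@right_coideal K H) M W /\ forall y, W y -> generated_over x0 y.
Proof.
case=> x0 nMx0; have [s s0] := rhit_lspan x0.
have [|||||W minW W0] := @exists_minimal_over K H (@right_coideal K H) M (generated_over x0) s.
- exact: generated_over_coideal.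
- exact: generated_over_subspace.
- exact: generated_over_sub.
- by exists x0 => //; exact: generated_over_mem.
- by move=> y [chi My]; exists (rhit chi x0).
by exists x0, W.
Qed.

Variables (x0 : H) (W : H -> Prop).
Hypotheses (minW : minimal_over (@right_coideal K H) M W)
  (W0 : forall y, W y -> generated_over x0 y).

Definition annihilates phi : Prop := forall m, M m -> phi m = 0.

Lemma simple_generated m w : W m -> ~ M m -> W w -> exists psi, M (w - rhit psi m).
Proof.
case: minW => rW sW MW _ mW Wm nMm Ww.
have := mW (generated_over m).
apply=> //.
- exact: generated_over_coideal.
- exact: generated_over_subspace.
- exact: generated_over_sub.
- move=> y [chi My]; rewrite -[y](subrK (rhit chi m)).
  by apply: (subspaceD sW); [exact: MW|exact: rW].
- by exists m => //; exact: generated_over_mem.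
Qed.

Local Notation lsum l := (\sum_(p <- l) lhit p.1 p.2).
Definition good_terms (l : seq (dual * H)) : Prop :=
  forall p, p \in l -> annihilates p.1 /\ W p.2.

Lemma good_terms_cons p l :
  good_terms (p :: l) -> [/\ annihilates p.1, W p.2 & good_terms l].
Proof.
move=> gl; have [? ?] := gl p (mem_head _ _); split=> // q ql.
by apply: gl; rewrite inE ql orbT.
Qed.

Definition coefficients y : Prop := exists2 l, good_terms l & y = lsum l.

Lemma coefficients_subspace : is_subspace coefficients.
Proof.
split; first by exists [::]; rewrite ?big_nil.
have sW : is_subspace W by case: minW.
move=> a _ _ [l gl ->] [l' gl' ->]; exists ([seq (p.1, a *: p.2) | p <- l] ++ l').
  move=> p; rewrite mem_cat => /orP[/mapP[q /gl[? ?] ->]|/gl'//].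
  by split=> //; apply: (subspaceZ sW).
rewrite big_cat big_map scaler_sumr /=; congr (_ + _); apply: eq_bigr => p _.
by rewrite (linear_ofZ (lhit_linear p.1)).
Qed.

Lemma coefficients_right : right_coideal coefficients.
Proof.
have rW : right_coideal W by case: minW.
move=> chi _ [l gl ->]; exists [seq (p.1, rhit chi p.2) | p <- l].
  by move=> p /mapP[q /gl[? ?] ->]; split=> //; apply: rW.
rewrite big_map (linear_of_sum (rhit_linear chi)); apply: eq_bigr => p _.
by rewrite lhit_rhit.
Qed.

Lemma annihilatesM phi psi : annihilates phi -> annihilates (phi * psi).
Proof.
move=> aphi m Mm; rewrite -counit_lhit -lhitM (right_coideal_kills sM rM aphi Mm).
by rewrite (linear_of0 (lhit_linear psi)) (raddf0 (@counit K H)).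
Qed.

Lemma coefficients_left : left_coideal coefficients.
Proof.
move=> phi _ [l gl ->]; exists [seq (p.1 * phi, p.2) | p <- l].
  by move=> p /mapP[q /gl[? ?] ->]; split=> //; apply: annihilatesM.
rewrite big_map (linear_of_sum (lhit_linear phi)); apply: eq_bigr => p _.
by rewrite lhitM.
Qed.

Lemma coefficients_nonzero : exists2 y, coefficients y & y <> 0.
Proof.
have [_ sW MW [w Ww nMw] _] := minW.
have [phi [phil phiM phiw]] := exists_functional sM nMw.
exists (lhit (to_conv phil) w).
  exists [:: (to_conv phil, w)]; last by rewrite big_seq1.
  by move=> p; rewrite inE => /eqP->.
move=> /(congr1 (@counit K H)); rewrite counit_lhit (raddf0 (@counit K H)).
by rewrite to_convE phiw => /eqP; rewrite oner_eq0.
Qed.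

Lemma coefficients_lspan : exists s, forall y, coefficients y -> lspan s y.
Proof.
have [s1 s1P] := rhit_lspan x0; have [s s1s] := lhit_lspan_lspan s1.
exists s => _ [l gl ->]; apply: (subspace_sum (lspan_subspace s)) => p /gl[ap Wp].
have [chi Mchi] := W0 Wp.
have -> : lhit p.1 p.2 = lhit p.1 (rhit chi x0).
  apply/eqP; rewrite -subr_eq0 -(linear_ofB (lhit_linear p.1)).
  by rewrite (right_coideal_kills sM rM ap Mchi).
exact: s1s.
Qed.

(** Take a shortest expression of g as a sum of terms [lhit phi w].  If some
w were not an eigenvector modulo M with character chi |-> chi(g), subtracting
chi(g) g from [rhit chi g] would give a relation between the terms; as W / M is
simple, the term of w could then be expressed through the others. *)
Lemma skew_of_coefficients g : grouplike g -> coefficients g ->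
  exists2 x, ~ M x & forall chi, M (rhit chi x - (chi g : K) *: x).
Proof.
move=> gg [l gl Eg]; have [rW sW MW _ _] := minW.
have [n] := ubnP (size l); elim: n l gl Eg => // n IHn [|[phi w] l] gl Eg ltln.
  by case: gg => g0 _; case: g0; rewrite Eg big_nil.
have [/= aphi Ww gl'] := good_terms_cons gl.
pose d chi y := rhit chi y - (chi g : K) *: y.
have Wd chi y : W y -> W (d chi y).
  by move=> Wy; apply: (subspaceB sW); [exact: rW|exact: (subspaceZ sW)].
have [skew|] := pselect (forall chi, M (d chi w)).
  have [Mw|nMw] := pselect (M w); last by exists w.
  apply: (IHn l) => //; rewrite Eg big_cons.
  by rewrite (right_coideal_kills sM rM aphi Mw) add0r.
move=> /existsNP[chi nMd].
(* The relation: the [d chi] of all terms add up to [d chi g], which is 0. *)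
have E : lhit phi (d chi w) = - \sum_(p <- l) lhit p.1 (d chi p.2).
  have d_lhit psi y : lhit psi (d chi y) = d chi (lhit psi y).
    by rewrite (linear_ofB (lhit_linear psi)) (linear_ofZ (lhit_linear psi)) lhit_rhit.
  have dl : linear (d chi).
    move=> a y z; rewrite /d (rhit_linear chi) scalerBr scalerDr !scalerA mulrC.
    by rewrite opprD addrACA.
  apply/eqP; rewrite -addr_eq0 d_lhit (eq_bigr (fun p => d chi (lhit p.1 p.2))) //.
  rewrite -(linear_of_sum dl) -(linear_ofD dl).
  by move: Eg; rewrite big_cons => <-; rewrite /d rhit_grouplike // subrr.
have [psi Mpsi] := simple_generated (Wd chi w Ww) nMd Ww.
apply: (IHn [seq (p.1, p.2 - rhit psi (d chi p.2)) | p <- l]).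
- move=> p /mapP[q /gl'[? ?] ->]; split=> //=.
  by apply: (subspaceB sW) => //; apply: rW; apply: Wd.
- rewrite Eg big_cons big_map /=.
  have -> : lhit phi w = lhit phi (rhit psi (d chi w)).
    apply/eqP; rewrite -subr_eq0 -(linear_ofB (lhit_linear phi)).
    by rewrite (right_coideal_kills sM rM aphi Mpsi).
  rewrite lhit_rhit E (linear_ofN (rhit_linear psi)).
  rewrite (linear_of_sum (rhit_linear psi)) addrC -sumrB.
  apply: eq_bigr => p _.
  by rewrite -lhit_rhit -(linear_ofB (lhit_linear p.1)).
- by rewrite size_map.
Qed.

End Skew.

(** H / M contains a one-dimensional comodule, given by a grouplike: a step of the
coradical filtration, started at an arbitrary right coideal M. *)
Lemma exists_skew (H_pointed : pointed H) M : is_subspace M -> right_coideal M ->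
  (exists x, ~ M x) -> exists g x, [/\ grouplike g, ~ M x &
    forall chi, M (rhit chi x - (chi g : K) *: x)].
Proof.
move=> sM rM exM; have [x0 [W [minW W0]]] := exists_simple_over sM rM exM.
have [s sP] := coefficients_lspan sM rM W0.
have [g gg Cg] := pointed_grouplike_in H_pointed (coefficients_subspace minW)
  (coefficients_left sM rM (W := W)) (coefficients_right minW) (coefficients_nonzero sM minW) sP.
have [x nMx xP] := skew_of_coefficients sM rM minW gg Cg.
by exists g, x.
Qed.

(** Let M be the largest subcoalgebra contained in the kernel of p.  If M were
proper, there would be x outside M with Δ(x) - x (x) g in M (x) H.  Then
p(x) = (p * p)(x) lies in p(M) p(H) + p(x) p(g) = 0, and likewise for all
elements of the subcoalgebra generated by x, so that x would lie in M. *)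
Lemma conv_idem_eq0 (H_pointed : pointed H) (B : algType K) (p : conv H B) :
  p * p = p -> (forall g, grouplike g -> p g = 0) -> p = 0.
Proof.
move=> pp pg; pose M x := forall phi chi, p (lhit phi (rhit chi x)) = 0.
have sM : is_subspace M.
  split=> [phi chi|a x y Mx My phi chi].
    by rewrite (linear_of0 (rhit_linear chi)) (linear_of0 (lhit_linear phi)) raddf0.
  by rewrite (rhit_linear chi) (lhit_linear phi) (conv_is_linear p) Mx My scaler0 addr0.
have rM : right_coideal M by move=> psi x Mx phi chi; rewrite rhitM.
have lM : left_coideal M by move=> psi x Mx phi chi; rewrite -lhit_rhit lhitM.
have Mp x : M x -> p x = 0 by move=> /(_ 1 1); rewrite lhit1 rhit1.
have [allM|] := pselect (forall x, M x); first by apply: convP => h; apply: Mp.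
move=> /existsNP exM; have [g [x [gg nMx xP]]] := exists_skew H_pointed sM rM exM.
case: nMx => phi chi; pose y := lhit phi x.
have py : p y = 0.
  pose t := comul y - y \ox g.
  have tM (psi : H -> K^o) : linear psi -> M (tensor_lift (fun a b : H => (psi b : K) *: a) t).
    move=> psil; have L : linear (tensor_lift (fun a b : H => (psi b : K) *: a)).
      by apply: tensor_lift_linear => u;
        [apply: scale_linearr|apply: scale_linearl].
    rewrite (linear_ofB L) tensor_liftE => [|u|u]; [|exact: scale_linearr|exact: scale_linearl].
    have -> : tensor_lift (fun a b : H => (psi b : K) *: a) (comul y) =
              lhit phi (rhit (to_conv psil) x) by rewrite lhit_rhit.
    rewrite -(linear_ofZ (lhit_linear phi)) -(linear_ofB (lhit_linear phi)).
    exact/lM/xP.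
  have [|||s Es sP] := @tensor_subspace K H H t M (fun=> True) sM.
  - by [].
  - exact: tM.
  - by [].
  have L : linear (tensor_lift (fun a b : H => p a * p b)).
    by apply: tensor_lift_linear => u; lin.
  rewrite -[in LHS]pp convM /sweedler -[comul y](subrK (y \ox g)) -/t.
  rewrite (linear_ofD L) tensor_liftE => [|u|u]; [|by lin|by lin].
  rewrite (pg g gg) mulr0 addr0 Es tensor_lift_sum => [|u|u]; [|by lin|by lin].
  by rewrite big_seq big1 // => q /sP[/Mp-> _]; rewrite mul0r.
have -> : lhit phi (rhit chi x) = lhit phi (rhit chi x - (chi g : K) *: x) + (chi g : K) *: y.
  by rewrite (linear_ofB (lhit_linear phi)) (linear_ofZ (lhit_linear phi)) subrK.
by rewrite (linear_ofD (conv_is_linear p)) (linear_ofZ (conv_is_linear p)) py scaler0 addr0; apply/Mp/lM/xP.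
Qed.

(** p - p * q and q - p * q are idempotents which vanish on G. *)
Lemma conv_idem_inj (H_pointed : pointed H) (B : algType K) (p q : conv H B) :
  p * p = p -> q * q = q -> p * q = q * p ->
  (forall g, grouplike g -> p g = q g) -> p = q.
Proof.
move=> pp qq pq E.
have half (p' q' : conv H B) : p' * p' = p' -> q' * q' = q' -> p' * q' = q' * p' ->
    (forall g, grouplike g -> p' g = q' g) -> p' = p' * q'.
  move=> pp' qq' pq' E'; apply/eqP; rewrite -subr_eq0; apply/eqP.
  apply: conv_idem_eq0 => // [|g gg].
    have pr : p' * (p' * q') = p' * q' by rewrite mulrA pp'.
    have rp : p' * q' * p' = p' * q' by rewrite pq' -mulrA pp'.
    have rr : p' * q' * (p' * q') = p' * q' by rewrite mulrA rp -mulrA qq'.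
    by rewrite mulrBl !mulrBr pp' pr rp rr subrr subr0.
  rewrite convB (conv_mul_grouplike _ _ gg) -E' // -(conv_mul_grouplike _ _ gg).
  by rewrite pp' subrr.
by rewrite (half p q) // pq -half // => g gg; rewrite E.
Qed.

End Rigidity.

(** * The idempotents P_X *)

Section AparEps.
Variables (K : fieldType) (H : hopfAlgType K).
Implicit Types h k : H.
Local Notation A := (Apar H).
Local Notation swd := (@sweedler K H _).

Fact eps_linear : linear (@eps K H).
Proof. by move=> a x y; apply: val_inj; rewrite /= -!eps_convE linearP. Qed.

HB.instance Definition _ :=
  GRing.isLinear.Build K H (Apar H) _ (@eps K H) eps_linear.

Definition epsc : conv H A := to_conv eps_linear.

Lemma epscE h : epsc h = eps h. Proof. by []. Qed.

Lemma eps1 : eps (1 : H) = 1.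
Proof.
apply: val_inj; rewrite /= /eps_Hpar sweedler1; [|by move=> ?; lin..].
by rewrite antipode1 brak1 mulr1.
Qed.

Let val_linear : linear (@Apar_val K H). Proof. by []. Qed.

Lemma epsc_idem : epsc * epsc = epsc.
Proof.
apply: convP => h; apply: val_inj; rewrite convM /=.
rewrite (sweedler_comp _ _ val_linear).
by rewrite -[RHS]eps_convE -eps_conv_idem convM.
Qed.

Lemma translate_epsc_comm k : translate k epsc * epsc = epsc * translate k epsc.
Proof.
apply: convP => h; apply: val_inj; rewrite !convM /=.
rewrite !(sweedler_comp _ _ val_linear).
have := congr1 (fun f : conv H (Hpar H) => f h) (translate_eps_comm k).
by rewrite !convM.
Qed.

Lemma Apar_gen_ind (Q : A -> Prop) :
  (forall h, Q (eps h)) -> Q 1 ->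
  (forall a x y, Q x -> Q y -> Q (a *: x + y)) ->
  (forall x y, Q x -> Q y -> Q (x * y)) -> forall a, Q a.
Proof.
move=> Qeps Q1 Ql QM [x Ax]; have Ix : in_Apar x by apply/asboolP.
elim: Ix Ax => {x} [h||a x y Ix IHx Iy IHy|x y Ix IHx Iy IHy] Axy.
- by rewrite (_ : InApar _ = eps h) //; apply: val_inj.
- by rewrite (_ : InApar _ = 1) //; apply: val_inj.
- rewrite (_ : InApar _ = a *: InApar (asboolT Ix) + InApar (asboolT Iy)).
    exact: Ql.
  exact: val_inj.
- rewrite (_ : InApar _ = InApar (asboolT Ix) * InApar (asboolT Iy)).
    exact: QM.
  exact: val_inj.
Qed.

End AparEps.

Section CentralIdempotents.
Variable A : nzRingType.
Implicit Types a b c : A.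

Definition central_idem c : Prop := (forall a, c * a = a * c) /\ c * c = c.

Lemma central_idem1 : central_idem 1.
Proof. by split=> [a|]; rewrite mulr1 ?mul1r. Qed.

Lemma central_idem_morph c a b : central_idem c -> a * b * c = a * c * (b * c).
Proof. by move=> [cc cI]; rewrite -[RHS]mulrA (mulrA c) cc -(mulrA b) cI mulrA. Qed.

Lemma central_idemM c d : central_idem c -> central_idem d -> central_idem (c * d).
Proof.
move=> [cc cI] [dc dI]; split=> [a|]; first by rewrite -mulrA dc mulrA cc mulrA.
by rewrite -mulrA (mulrA d) (dc c) -(mulrA c d) dI mulrA cI.
Qed.

Lemma central_idemC c : central_idem c -> central_idem (1 - c).
Proof.
move=> [cc cI]; split=> [a|]; first by rewrite mulrBl mulrBr mul1r mulr1 cc.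
by rewrite mulrBl mul1r mulrBr mulr1 cI subrr subr0.
Qed.

Lemma central_idem_prod (I : Type) (r : seq I) (P : pred I) F :
  (forall i, central_idem (F i)) -> central_idem (\prod_(i <- r | P i) F i).
Proof.
move=> FC; elim/big_rec: _ => [|i c _ cC]; first exact: central_idem1.
exact: central_idemM.
Qed.

Lemma central_prod_absorb (I : eqType) (r : seq I) (P : pred I) F t :
  (forall i, central_idem (F i)) -> t \in r -> P t ->
  F t * \prod_(i <- r | P i) F i = \prod_(i <- r | P i) F i.
Proof.
move=> FC + Pt; elim: r => // i r IHr; rewrite inE big_cons => /orP[/eqP <-|tr].
  by rewrite Pt mulrA (FC t).2.
by case: (P i); rewrite ?IHr // mulrA (FC t).1 -mulrA IHr.
Qed.

Lemma prod_stable (I : Type) (r : seq I) (P : pred I) F b :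
  (forall i, P i -> F i * b = b) -> (\prod_(i <- r | P i) F i) * b = b.
Proof.
move=> Fb; elim/big_rec: _ => [|i c Pi cb]; first exact: mul1r.
by rewrite -mulrA cb Fb.
Qed.

End CentralIdempotents.

Section Grouplikes.
Variables (K : fieldType) (H : hopfAlgType K) (gT : finGroupType) (g : gT -> H).
Hypothesis gP : is_grouplike_group g.
Implicit Types (x y t : gT) (X Y : {set gT}) (h k : H).
Local Notation A := (Apar H).
Local Notation T := (@translate K H A).
Local Notation swd := (@sweedler K H _).

Lemma g_grouplike x : grouplike (g x).
Proof. by case: gP => _ _ gl; apply/gl; exists x. Qed.

Lemma gM x y : g (x * y)%g = g x * g y.
Proof. by case: gP. Qed.

Lemma g1 : g 1%g = 1.
Proof.
case: gP => _ _ gl; have /gl[x Ex] := grouplike1 H.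
by rewrite -[g 1%g]mulr1 Ex -gM mul1g.
Qed.

Lemma gV x : g x^-1%g * g x = 1.
Proof. by rewrite -gM mulVg g1. Qed.

Lemma gK x : g x * g x^-1%g = 1.
Proof. by rewrite -gM mulgV g1. Qed.

Lemma eps_g_idem x : eps (g x) * eps (g x) = eps (g x).
Proof.
have := congr1 (fun f : conv H A => f (g x)) (epsc_idem H).
by rewrite (conv_mul_grouplike _ _ (g_grouplike x)).
Qed.

(** At the grouplike g = g_x, the relation between ε and T_k ε reads
ε_(g k) ε_g = ε_g ε_(g k); take k = g^-1 h. *)
Lemma eps_g_comm x h : eps (g x) * eps h = eps h * eps (g x).
Proof.
have := congr1 (fun f : conv H A => f (g x)) (translate_epsc_comm (g x^-1%g * h)).
rewrite !(conv_mul_grouplike _ _ (g_grouplike x)) !translateE mulrA gK mul1r.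
by rewrite !epscE.
Qed.

Lemma eps_central x : central_idem (eps (g x)).
Proof.
split; last exact: eps_g_idem.
apply: Apar_gen_ind => [h||c a b aC bC|a b aC bC].
- exact: eps_g_comm.
- by rewrite mul1r mulr1.
- by rewrite mulrDr mulrDl -scalerAr -scalerAl aC bC.
- by rewrite mulrA aC -mulrA bC mulrA.
Qed.

Lemma PX_central X : central_idem (PX g X).
Proof.
apply: central_idemM; apply: central_idem_prod => x; first exact: eps_central.
exact/central_idemC/eps_central.
Qed.

Lemma eps_PX X t : eps (g t) * PX g X = PX g X *+ (t \in X).
Proof.
rewrite /PX mulrA; case: (boolP (t \in X)) => tX.
  rewrite (central_prod_absorb (F := fun x => eps (g x))) ?mem_index_enum //.
  exact: eps_central.
rewrite (eps_central t).1 -mulrA.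
have tX' : t \in ~: X by rewrite inE.
rewrite -(central_prod_absorb (F := fun y => 1 - eps (g y)) _ (mem_index_enum t) tX').
  by rewrite [eps _ * (_ * _)]mulrA mulrBr mulr1 eps_g_idem subrr mul0r mulr0.
by move=> x; apply/central_idemC/eps_central.
Qed.

Lemma PX_absorb X (b : A) :
  (forall t, eps (g t) * b = b *+ (t \in X)) -> PX g X * b = b.
Proof.
move=> Eb; rewrite /PX -mulrA (@prod_stable _ _ _ _ _ b) => [|t]; last first.
  by rewrite inE => tX; rewrite mulrBl mul1r Eb (negbTE tX) subr0.
by apply: prod_stable => t tX; rewrite Eb tX.
Qed.

Lemma PX_orthogonal X Y : X != Y -> PX g X * PX g Y = 0.
Proof.
move=> XY; have [t tXY] : exists t, (t \in X) != (t \in Y).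
  apply/existsP; rewrite -negb_forall; apply: contra XY => /forallP E.
  by apply/eqP/setP => t; apply/eqP/E.
have : (eps (g t) * PX g X) * PX g Y = PX g X * (eps (g t) * PX g Y).
  by rewrite (eps_central t).1 mulrA.
rewrite !eps_PX mulrnAl mulrnAr.
by move: tXY; case: (t \in X); case: (t \in Y) => //= _; rewrite ?mulr1n ?mulr0n.
Qed.

(** If a is nonzero, one can decide for each t in turn whether t belongs to X,
multiplying a by ε_t if the product does not vanish; the nonzero result is fixed
by P_X. *)
Lemma PX_separate (a : A) :
  (forall X, X \in P1 gT -> a * PX g X = 0) -> a = 0.
Proof.
move=> aX; apply: contrapT => a0.
have [c [X [cC ac0 Xc]]] : exists c X, [/\ forall b, c * b = b * c, a * c <> 0 &
    forall t, eps (g t) * (a * c) = (a * c) *+ (t \in X)].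
  suff [c [X [cC ac0 Xc]]] : exists c X, [/\ forall b, c * b = b * c, a * c <> 0 &
      forall t, t \in enum gT -> eps (g t) * (a * c) = (a * c) *+ (t \in X)].
    by exists c, X; split=> // t; apply: Xc; rewrite mem_enum.
  elim: (enum gT) => [|t r [c [X [cC ac0 Xc]]]].
    by exists 1, set0; split=> // [b|]; rewrite ?mulr1 // mul1r.
  have [tr|tr] := boolP (t \in r).
    by exists c, X; split=> // s; rewrite inE => /predU1P[->|]; apply: Xc.
  have [z|/eqP nz] := eqVneq (eps (g t) * (a * c)) 0.
    exists c, (X :\ t); split=> // s; rewrite !inE => /predU1P[->|sr].
      by rewrite eqxx z.
    by rewrite (Xc _ sr) (_ : s != t) //; apply: contraNneq tr => <-.
  exists (eps (g t) * c), (t |: X).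
  have E : a * (eps (g t) * c) = eps (g t) * (a * c).
    by rewrite mulrA -(eps_central t).1 mulrA.
  split=> [b||s].
  - by rewrite -mulrA cC mulrA (eps_central t).1 mulrA.
  - by rewrite E.
  rewrite !inE E => /predU1P[->|sr]; first by rewrite eqxx mulrA eps_g_idem.
  rewrite (negbTE (_ : s != t)) /=; last by apply: contraNneq tr => <-.
  by rewrite mulrA (eps_central s).1 -mulrA (Xc _ sr) mulrnAr.
have X1 : X \in P1 gT.
  rewrite inE; apply: contrapT => /negP X1; apply: ac0.
  by have := Xc 1%g; rewrite g1 eps1 mul1r (negbTE X1).
by apply: ac0; rewrite -(PX_absorb Xc) (PX_central X).1 -mulrA cC mulrA aX // mul0r.
Qed.

End Grouplikes.

(** * The Boolean algebra generated by the translates of ε *)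

Section Boolean.
Variables (K : fieldType) (H : hopfAlgType K) (gT : finGroupType) (g : gT -> H).
Hypothesis gP : is_grouplike_group g.
Implicit Types (x y t : gT) (X Y : {set gT}) (h k : H).
Local Notation A := (Apar H).
Local Notation T := (@translate K H A).
Local Notation swd := (@sweedler K H _).
Local Notation ε := (epsc H).
Implicit Types f : conv H A.

Inductive boolean : conv H A -> Prop :=
| boolean_eps x : boolean (T (g x) ε)
| boolean1 : boolean 1
| booleanM f f' of boolean f & boolean f' : boolean (f * f')
| booleanC f of boolean f : boolean (1 - f).

Lemma boolean_epsc : boolean ε.
Proof. by rewrite -(translate1 ε) -(g1 gP); apply: boolean_eps. Qed.

Lemma boolean_prod (I : Type) (r : seq I) (P : pred I) F :
  (forall i, boolean (F i)) -> boolean (\prod_(i <- r | P i) F i).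
Proof.
move=> bF; elim/big_rec: _ => [|i f _ bf]; first exact: boolean1.
exact: booleanM.
Qed.

Lemma boolean_translate x f : boolean f -> boolean (T (g x) f).
Proof.
have gg := g_grouplike gP x.
elim=> {f} [y||f f' _ bf _ bf'|f _ bf].
- by rewrite translateA -gM //; apply: boolean_eps.
- by rewrite (translate_oneg _ gg); apply: boolean1.
- by rewrite (translate_mulg _ _ gg); apply: booleanM.
- by rewrite linearB /= (translate_oneg _ gg); apply: booleanC.
Qed.

(** The commutation relation between ε and T_k ε for all k in H, and not only for k
in G, is what [Apar_universal] asks of an idempotent; the Boolean elements are
in the commutant of all T_k ε. *)
Definition commutes_eps f : Prop := forall k, f * T k ε = T k ε * f.

Lemma boolean_commutes_eps f : boolean f -> commutes_eps f.
Proof.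
elim=> {f} [x||f f' _ cf _ cf'|f _ cf] k.
- have gg := g_grouplike gP x.
  have <- : g x * (g x^-1%g * k) = k by rewrite mulrA gK // mul1r.
  by rewrite -translateA -!translate_mulg // translate_epsc_comm.
- by rewrite mul1r mulr1.
- by rewrite -mulrA cf' mulrA cf mulrA.
- by rewrite mulrBl mulrBr mul1r mulr1 cf.
Qed.

Lemma boolean_comm_translate f f' k : boolean f -> commutes_eps f' ->
  f' * T k f = T k f * f'.
Proof.
move=> bf cf'; elim: bf k => {f} [x||f1 f2 _ IH1 _ IH2|f _ IHf] k.
- by rewrite translateA.
- by rewrite translate_one -scalerAl -scalerAr mul1r mulr1.
- rewrite translate_mul sweedler_mull sweedler_mulr.
  by apply: eq_sweedler => a b; rewrite mulrA IH1 -mulrA IH2 mulrA.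
- by rewrite linearB /= mulrBr mulrBl IHf translate_one -scalerAl -scalerAr mul1r mulr1.
Qed.

Lemma boolean_comm f f' : boolean f -> boolean f' -> f * f' = f' * f.
Proof.
move=> bf bf'; rewrite -[f']translate1; apply: boolean_comm_translate => //.
exact: boolean_commutes_eps.
Qed.

Lemma boolean_idem f : boolean f -> f * f = f.
Proof.
elim=> {f} [x||f f' bf ff bf' ff'|f _ ff].
- by rewrite -translate_mulg ?epsc_idem //; apply: g_grouplike.
- by rewrite mulr1.
- rewrite -mulrA (mulrA f') (boolean_comm bf' bf) -(mulrA f) ff' mulrA ff.
  by [].
- by rewrite mulrBl mul1r mulrBr mulr1 ff subrr subr0.
Qed.

(** Multiplied by a central idempotent, a Boolean element satisfies the
hypotheses of [Apar_universal]. *)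
Lemma boolean_morphism P f : central_idem P -> boolean f -> P * f 1 = P ->
  exists phi : {linear A -> A},
    [/\ {morph phi : x y / x * y}, phi 1 = P & forall h, phi (eps h) = P * f h].
Proof.
move=> [Pc PI] bf f1; pose u := conv_cst H P * f.
have uE h : u h = P * f h by apply: conv_cstMl.
have Pcc f' : conv_cst H P * f' = f' * conv_cst H P.
  by apply: convP => h; rewrite conv_cstMl conv_cstMr Pc.
have Tu k : T k u = conv_cst H P * T k f.
  by apply: convP => h; rewrite translateE uE conv_cstMl.
have [phi [phiM phi1 phiE]] : exists phi : {linear A -> A},
    [/\ {morph phi : x y / x * y}, phi 1 = u 1 & forall h, phi (eps h) = u h].
  apply: Apar_universal => [|k|h].
  - rewrite /u {1}Pcc -mulrA (mulrA _ _ f).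
    have -> : conv_cst H P * conv_cst H P = conv_cst H P.
      by apply: convP => h; rewrite conv_cstMl /= -scalerAr PI.
    by rewrite Pcc mulrA boolean_idem // -Pcc.
  - rewrite Tu /u -!mulrA; congr (_ * _).
    rewrite !mulrA -!Pcc -!mulrA; congr (_ * _).
    by rewrite (boolean_comm_translate _ bf) //; apply: boolean_commutes_eps.
  - by rewrite !uE f1 mulrA PI.
by exists phi; rewrite phi1 uE f1; split=> // h; rewrite phiE uE.
Qed.

(** [conv_idem_inj] for P f and P f', which commute because f and f' do. *)
Lemma boolean_inj (H_pointed : pointed H) P f f' : central_idem P ->
  boolean f -> boolean f' -> (forall t, P * f (g t) = P * f' (g t)) ->
  forall h, P * f h = P * f' h.
Proof.
move=> [Pc PI] bf bf' E.
have Pcc p : conv_cst H P * p = p * conv_cst H P.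
  by apply: convP => h; rewrite conv_cstMl conv_cstMr Pc.
have PP : conv_cst H P * conv_cst H P = conv_cst H P.
  by apply: convP => h; rewrite conv_cstMl /= -scalerAr PI.
have PM p q : conv_cst H P * p * (conv_cst H P * q) = conv_cst H P * (p * q).
  by rewrite -mulrA [p * _]mulrA -(Pcc p) -(mulrA _ p) mulrA PP.
have EE : conv_cst H P * f = conv_cst H P * f'.
  apply: conv_idem_inj => //; rewrite ?PM ?boolean_idem //.
    by rewrite (boolean_comm bf bf').
  move=> x; case: gP => _ _ gl /gl[t ->]; rewrite !conv_cstMl; exact: E.
by move=> h; rewrite -!conv_cstMl EE.
Qed.

Definition indicator P f (b : gT -> bool) : Prop :=
  forall t, P * f (g t) = P *+ b t.

Section Indicator.
Variable P : A.

Lemma indicator_eps X : indicator (PX g X) ε (mem X).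
Proof. by move=> t; rewrite epscE (PX_central gP X).1 eps_PX. Qed.

Lemma indicator_translate x f b :
  indicator P f b -> indicator P (T (g x) f) (fun t => b (t * x)%g).
Proof. by move=> fb t; rewrite translateE -gM. Qed.

Lemma indicatorM f f' b b' : indicator P f b -> indicator P f' b' ->
  indicator P (f * f') (fun t => b t && b' t).
Proof.
move=> fb fb' t; rewrite (conv_mul_grouplike _ _ (g_grouplike gP t)) mulrA fb.
by rewrite mulrnAl fb'; case: (b t); rewrite ?mul0rn.
Qed.

Lemma indicator1 : indicator P 1 xpredT.
Proof.
by move=> t; rewrite conv1 (grouplike_counit (g_grouplike gP t)) scale1r mulr1.
Qed.

Lemma indicatorC f b : indicator P f b -> indicator P (1 - f) (fun t => ~~ b t).
Proof.
move=> fb t; rewrite convB mulrBr indicator1 fb.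
by case: (b t); rewrite ?subrr ?subr0.
Qed.

Lemma indicator_prod (I : Type) (r : seq I) (Q : pred I) F b :
  (forall i, indicator P (F i) (b i)) ->
  indicator P (\prod_(i <- r | Q i) F i) (fun t => all (fun i => Q i ==> b i t) r).
Proof.
move=> Fb; elim: r => [|i r IHr] t; first by rewrite big_nil indicator1.
rewrite big_cons /=; case: (Q i) => /=; last exact: IHr.
exact: (indicatorM (Fb i) IHr).
Qed.

End Indicator.

(** The atom containing 1 of the Boolean algebra generated by the sets X x^-1: t
belongs to G_X when tx is in X exactly for those x which are in X. *)
Definition stabilizer_indicator X : conv H A :=
  \prod_(x in X) T (g x) ε * \prod_(x in ~: X) (1 - T (g x) ε).

Lemma boolean_stabilizer X : boolean (stabilizer_indicator X).
Proof.
apply: booleanM; apply: boolean_prod => x; first exact: boolean_eps.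
exact/booleanC/boolean_eps.
Qed.

Lemma indicator_stabilizer X :
  indicator (PX g X) (stabilizer_indicator X) (mem (GX X)).
Proof.
have ieps x : indicator (PX g X) (T (g x) ε) (fun t => (t * x)%g \in X).
  exact: (indicator_translate x (indicator_eps X)).
move=> t; rewrite (indicatorM (indicator_prod _ _ ieps)
  (indicator_prod _ _ (fun x => indicatorC (ieps x)))); congr (_ *+ nat_of_bool _).
apply/andP/idP => [[/allP XX /allP XC]|].
  rewrite !inE; apply/eqP/setP => x; rewrite mem_lcoset.
  apply/idP/idP => [tx|xX].
    have := XX (t^-1 * x)%g (mem_index_enum _).
    by rewrite tx mulKVg.
  apply: contraLR xX => tx; have := XC (t^-1 * x)%g (mem_index_enum _).
  by rewrite inE tx mulKVg.
rewrite !inE => /eqP tX; have E x : ((t * x)%g \in X) = (x \in X).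
  by rewrite -{1}tX mem_lcoset mulKg.
by split; apply/allP => x _; rewrite ?inE E implybb.
Qed.

(** The union over y in Y of the cosets G_X y.  It equals Y as soon as
G_X = G_Y. *)
Definition translates_indicator X Y : conv H A :=
  1 - \prod_(y in Y) (1 - T (g y^-1%g) (stabilizer_indicator X)).

Lemma boolean_translates X Y : boolean (translates_indicator X Y).
Proof.
apply/booleanC/boolean_prod => y; apply/booleanC/boolean_translate.
exact: boolean_stabilizer.
Qed.

Lemma indicator_translates X Y : GX X = GX Y ->
  indicator (PX g X) (translates_indicator X Y) (mem Y).
Proof.
move=> XY t; rewrite (indicatorC (indicator_prod _ _ (fun y => indicatorC
  (indicator_translate y^-1%g (indicator_stabilizer X))))).
congr (_ *+ nat_of_bool _); apply/allPn/idP => [[y _]|tY].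
  rewrite XY /= !inE negb_imply negbK => /andP[yY /eqP E].
  by rewrite -E mem_lcoset invMg invgK mulgKV.
exists t; first exact: mem_index_enum.
by have {}tY : t \in Y := tY; rewrite mulgV !inE lcoset1 eqxx tY.
Qed.

Lemma PX_morphism X Y : X \in P1 gT -> Y \in P1 gT -> GX X = GX Y ->
  exists (f : conv H A) (phi : {linear A -> A}),
    [/\ boolean f, indicator (PX g X) f (mem Y), {morph phi : x y / x * y},
        phi 1 = PX g X & forall h, phi (eps h) = PX g X * f h].
Proof.
move=> X1 Y1 XY; have bf := boolean_translates X Y; have fY := indicator_translates XY.
have [|phi [phiM phi1 phiE]] := boolean_morphism (PX_central gP X) bf.
  rewrite -(g1 gP) fY -[mem Y 1%g]/(1%g \in Y).
  by move: Y1; rewrite inE => ->.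

by exists (translates_indicator X Y), phi.
Qed.

Lemma morphism_PX (phi : {linear A -> A}) P Y :
  {morph phi : x y / x * y} -> phi 1 = P ->
  (forall t, phi (eps (g t)) = P *+ (t \in Y)) -> phi (PX g Y) = P.
Proof.
move=> phiM phi1 phiE; have PI : P * P = P by rewrite -phi1 -phiM mulr1.
have prod (I : Type) (r : seq I) (Q : pred I) F :
    (forall i, Q i -> phi (F i) = P) -> phi (\prod_(i <- r | Q i) F i) = P.
  by move=> FP; elim/big_rec: _ => // i a Qi Ea; rewrite phiM Ea FP.
rewrite phiM !prod // => t; rewrite ?inE => tY.
  by rewrite linearB /= phi1 phiE (negbTE tY) subr0.
by rewrite phiE tY.
Qed.

(** psi maps the Boolean elements for Y to Boolean elements for X up to the
factor P_X, so psi o phi sends ε to P_X b for a Boolean b; on G, P_X b agrees with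
P_X ε, hence they are equal by rigidity. *)
Lemma PX_morphismK (H_pointed : pointed H) X Y f f' (phi psi : {linear A -> A}) :
  boolean f -> indicator (PX g X) f (mem Y) -> {morph psi : x y / x * y} ->
  psi 1 = PX g X -> (forall h, psi (eps h) = PX g X * f h) ->
  boolean f' -> indicator (PX g Y) f' (mem X) -> {morph phi : x y / x * y} ->
  phi 1 = PX g Y -> (forall h, phi (eps h) = PX g Y * f' h) ->
  forall a, psi (phi a) = a * PX g X.
Proof.
move=> bf fY psiM psi1 psiE bf' f'X phiM phi1 phiE.
have [Pc PI] := PX_central gP X.
have PK b : PX g X * (PX g X * b) = PX g X * b by rewrite mulrA PI.
have psiP : psi (PX g Y) = PX g X by apply: morphism_PX => // t; rewrite psiE fY.
have lift b : boolean b ->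
    exists2 b', boolean b' & forall h, psi (b h) = PX g X * b' h.
  elim=> {b} [x||b1 b2 _ [c1 bc1 E1] _ [c2 bc2 E2]|b _ [c bc E]].
  - by exists (T (g x) f) => [|h]; [apply: boolean_translate|rewrite -psiE].
  - exists 1 => [|h]; first exact: boolean1.
    by rewrite conv1 linearZ /= psi1 -scalerAr mulr1.
  - exists (c1 * c2) => [|h]; first exact: booleanM.
    rewrite !convM (sweedler_comp _ _ (linearP psi)) sweedler_mull.
    apply: eq_sweedler => x y; rewrite psiM E1 E2 -mulrA [c1 x * _]mulrA -(Pc (c1 x)).
    by rewrite -(mulrA _ (c1 x)) PK.
  - exists (1 - c) => [|h]; first exact: booleanC.
    rewrite !convB [psi _](linear_ofB (linearP psi)) mulrBr E; congr (_ - _).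
    by rewrite conv1 linearZ /= psi1 -scalerAr mulr1.
have [b' bb' Eb'] := lift f' bf'.
have key h : PX g X * b' h = PX g X * epsc H h.
  apply: (boolean_inj H_pointed (PX_central gP X) bb' boolean_epsc) => t.
  rewrite indicator_eps -Eb' -[psi (f' _)](_ : PX g X * psi (f' (g t)) = _).
    by rewrite -psiP -psiM f'X linearMn psiP.
  by rewrite Eb' PK.
apply: Apar_gen_ind => [h||c a b Ea Eb|a b Ea Eb].
- by rewrite phiE psiM psiP Eb' PK key -Pc.
- by rewrite phi1 psiP mul1r.
- by rewrite !linearP /= Ea Eb mulrDl scalerAl.
- by rewrite phiM psiM Ea Eb -(mulrA a) -(Pc b) PK (Pc b) mulrA.
Qed.

End Boolean.

(** * Isomorphisms between corners *)

Section CornerIso.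
Variables (K : fieldType) (A : algType K).
Implicit Types P Q R : A.

(** An isomorphism between the algebras A P and A Q for central idempotents P and
Q, given by maps defined on all of A: precomposing with the projection
a |-> a P makes the isomorphism a non-unital endomorphism of A. *)
Definition corner_iso P Q : Prop :=
  exists phi psi : {linear A -> A},
    [/\ {morph phi : x y / x * y} /\ {morph psi : x y / x * y},
        phi 1 = Q, psi 1 = P,
        forall a, psi (phi a) = a * P & forall a, phi (psi a) = a * Q].

Lemma corner_iso_trans P Q R : corner_iso P Q -> corner_iso Q R -> corner_iso P R.
Proof.
move=> [phi [psi [[phiM psiM] phi1 psi1 phiK psiK]]].
move=> [phi' [psi' [[phiM' psiM'] phi1' psi1' phiK' psiK']]].
have psiQ : psi Q = P by rewrite -phi1 phiK mul1r.
have phiQ : phi' Q = R by rewrite -psi1' psiK' mul1r.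
exists (phi' \o phi), (psi \o psi'); split=> [|||a|a] /=.
- by split=> x y /=; rewrite ?phiM ?phiM' ?psiM' ?psiM.
- by rewrite phi1.
- by rewrite psi1'.
- by rewrite phiK' psiM phiK psiQ -mulrA -psi1 -psiM mulr1.
- by rewrite psiK phiM' psiK' phiQ -mulrA -phi1' -phiM' mulr1.
Qed.

End CornerIso.

Section Conjugation.
Variables (K : fieldType) (H : hopfAlgType K) (gT : finGroupType) (g : gT -> H).
Hypothesis gP : is_grouplike_group g.
Implicit Types (x y t : gT) (X Y : {set gT}) (h k : H).
Local Notation A := (Apar H).
Local Notation swd := (@sweedler K H _).

Definition conjH x h : H := g x * h * g x^-1%g.

Lemma conjHM x h k : conjH x (h * k) = conjH x h * conjH x k.
Proof. by rewrite /conjH !mulrA -(mulrA _ (g x^-1%g) (g x)) gV // mulr1. Qed.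

Lemma conjHK x h : conjH x^-1%g (conjH x h) = h.
Proof. by rewrite /conjH invgK !mulrA gV // mul1r -mulrA gV // mulr1. Qed.

Lemma conjH_g x t : conjH x (g t) = g (t ^ x^-1)%g.
Proof. by rewrite /conjH -!gM // conjgE invgK mulgA. Qed.

Lemma sweedler_conjH (W : lmodType K) (F : H -> H -> W) x h :
  (forall v, linear (F^~ v)) -> (forall u, linear (F u)) ->
  swd (conjH x h) F = swd h (fun a b => F (conjH x a) (conjH x b)).
Proof.
move=> Fl Fr; have gg := g_grouplike gP.
have Ll u : linear (fun a : H => a * u) by lin.
have Lr u : linear (fun a : H => u * a) by lin.
have cl (W' : lmodType K) (p : H -> H) (q : H -> W') :
    linear p -> linear q -> linear (fun a => q (p a)).
  by move=> pl ql c a b; rewrite pl ql.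
rewrite [LHS]sweedlerM //.
transitivity (swd (g x * h) (fun a b => F (a * g x^-1%g) (b * g x^-1%g))).
  apply: eq_sweedler => a b; apply: (sweedler_grouplike _ _ (gg _)) => u.
    exact: cl (Lr a) (Fl _).
  exact: cl (Lr b) (Fr _).
rewrite sweedlerM => [|v|u]; [|exact: cl (Ll _) (Fl _)|exact: cl (Ll _) (Fr _)].
rewrite exchange_sweedler; apply: eq_sweedler => a b.
apply: (sweedler_grouplike _ _ (gg _)) => u.
  exact: cl (Ll a) (cl _ _ _ (Ll _) (Fl _)).
exact: cl (Ll b) (cl _ _ _ (Ll _) (Fr _)).
Qed.

Fact conjH_linear x : linear (conjH x).
Proof. by rewrite /conjH; lin. Qed.

Fact eps_conj_linear x : linear (fun h => epsc H (conjH x h)).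
Proof. by move=> a h k; rewrite conjH_linear linearP. Qed.
Definition eps_conj x : conv H A := to_conv (eps_conj_linear x).

Lemma eps_conjE x h : eps_conj x h = eps (conjH x h). Proof. by []. Qed.

Lemma conj_morphism x : exists phi : {linear A -> A},
  [/\ {morph phi : a b / a * b}, phi 1 = 1 & forall h, phi (eps h) = eps (conjH x h)].
Proof.
have Tc k h : translate k (eps_conj x) h = translate (conjH x k) (epsc H) (conjH x h).
  by rewrite !translateE eps_conjE conjHM.
have c1 : conjH x 1 = 1 by rewrite /conjH mulr1 gK.
have [phi [phiM phi1 phiE]] : exists phi : {linear A -> A},
    [/\ {morph phi : x y / x * y}, phi 1 = eps_conj x 1 &
        forall h, phi (eps h) = eps_conj x h].
  apply: Apar_universal => [|k|h].
  - apply: convP => h; rewrite convM eps_conjE -epscE -[in RHS]epsc_idem convM.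
    by rewrite sweedler_conjH => [|?|?]; [|by lin..].
  - apply: convP => h.
    have := congr1 (fun f : conv H A => f (conjH x h))
                   (translate_epsc_comm (conjH x k)).
    rewrite !convM !sweedler_conjH; [|by move=> ?; lin..].
    by move=> E; apply: etrans (etrans E _); apply: eq_sweedler => a b; rewrite Tc.
  - by rewrite eps_conjE c1 eps1 mul1r.
by exists phi; rewrite phi1 eps_conjE c1 eps1.
Qed.

(** An automorphism of A permuting the ε_t like an automorphism of G permutes the
P_X. *)
Lemma corner_iso_conj X x : corner_iso (PX g X) (PX g (X :^ x)%g).
Proof.
have [phi [phiM phi1 phiE]] := conj_morphism x^-1%g.
have [psi [psiM psi1 psiE]] := conj_morphism x.
have phiK a : psi (phi a) = a.
  elim/Apar_gen_ind: a => [h||c a b Ea Eb|a b Ea Eb].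
  - by rewrite phiE psiE -{1}(invgK x) conjHK.
  - by rewrite phi1 psi1.
  - by rewrite !linearP /= Ea Eb.
  - by rewrite phiM psiM Ea Eb.
have psiK a : phi (psi a) = a.
  elim/Apar_gen_ind: a => [h||c a b Ea Eb|a b Ea Eb].
  - by rewrite psiE phiE conjHK.
  - by rewrite psi1 phi1.
  - by rewrite !linearP /= Ea Eb.
  - by rewrite psiM phiM Ea Eb.
have [Pc PI] := PX_central gP X; have [Qc QI] := PX_central gP (X :^ x)%g.
have phiX : phi (PX g X) = PX g (X :^ x)%g.
  have E1 : PX g (X :^ x)%g * phi (PX g X) = phi (PX g X).
    apply: PX_absorb => t.
    have -> : eps (g t) = phi (eps (g (t ^ x^-1)%g)).
      by rewrite phiE conjH_g invgK conjgKV.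
    by rewrite -phiM eps_PX // linearMn mem_conjg.
  have E2 : PX g X * psi (PX g (X :^ x)%g) = psi (PX g (X :^ x)%g).
    apply: PX_absorb => t.
    have -> : eps (g t) = psi (eps (g (t ^ x)%g)).
      by rewrite psiE conjH_g conjgK.
    by rewrite -psiM eps_PX // linearMn memJ_conjg.
  by have := congr1 phi E2; rewrite phiM psiK -Qc E1.
have psiX : psi (PX g (X :^ x)%g) = PX g X by rewrite -phiX phiK.
have phil : linear (fun a => phi a * PX g (X :^ x)%g) by lin.
have psil : linear (fun a => psi a * PX g X) by lin.
exists (linear_of phil), (linear_of psil); split=> [|||a|a] /=.
- by split=> a b /=; rewrite ?phiM ?psiM; apply: central_idem_morph; apply: PX_central.
- by rewrite phi1 mul1r.
- by rewrite psi1 mul1r.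
- by rewrite psiM phiK psiX -mulrA PI.
- by rewrite phiM psiK phiX -mulrA QI.
Qed.

End Conjugation.

(** * Assembling the corners *)

Section Assembly.
Variables (K : fieldType) (H : hopfAlgType K) (gT : finGroupType) (g : gT -> H).
Hypotheses (H_pointed : pointed H) (gP : is_grouplike_group g).
Implicit Types (X Y : {set gT}).

Lemma corner_iso_stabilizer X Y : X \in P1 gT -> Y \in P1 gT -> GX X = GX Y ->
  corner_iso (PX g X) (PX g Y).
Proof.
move=> X1 Y1 XY.
have [f [psi [bf fY psiM psi1 psiE]]] := PX_morphism gP X1 Y1 XY.
have [f' [phi [bf' f'X phiM phi1 phiE]]] := PX_morphism gP Y1 X1 (esym XY).
exists phi, psi; split=> // a.
  exact: (PX_morphismK gP H_pointed bf fY psiM psi1 psiE bf' f'X phiM phi1 phiE).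
exact: (PX_morphismK gP H_pointed bf' f'X phiM phi1 phiE bf fY psiM psi1 psiE).
Qed.

Lemma group_P1 (L : {group gT}) : (L : {set gT}) \in P1 gT.
Proof. by rewrite inE group1. Qed.

Lemma GX_group (L : {group gT}) : GX L = L.
Proof.
apply/setP => t; rewrite inE; apply/eqP/idP => [E|tL]; last exact: lcoset_id.
by rewrite -E mem_lcoset mulVg.
Qed.

Lemma group_set_GX X : group_set (GX X).
Proof.
apply/group_setP; split=> [|s t]; first by rewrite inE lcoset1.
by rewrite !inE => /eqP sX /eqP tX; rewrite -{2}sX -{2}tX lcosetM.
Qed.

Lemma corner_iso_conj_stabilizer X (L : {group gT}) x : X \in P1 gT ->
  GX X = (L :^ x)%g -> corner_iso (PX g X) (PX g L).
Proof.
move=> X1 E; have LxV : (((L :^ x)%G :^ x^-1)%g = L :> {set gT}) by rewrite conjsgK.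
apply: (@corner_iso_trans _ _ _ (PX g (L :^ x)%G)); last first.
  by rewrite -[in X in corner_iso _ (PX g X)]LxV; apply: corner_iso_conj.
by apply: corner_iso_stabilizer => //; rewrite ?group_P1 // GX_group.
Qed.

Variable R : {set {group gT}}.
Hypothesis RP : conjugacy_representatives R.

(** The set X to which a summand corresponds: the index in 'I_(qG L) enumerates
the X in P_1(G) with G_X conjugate to L. *)
Definition summand_set (i : summand R) : {set gT} := enum_val (tagged (val i)).

Lemma summand_setP i : summand_set i \in P1 gT /\
  exists x, GX (summand_set i) = ((summand_group i) :^ x)%g.
Proof.
have := enum_valP (tagged (val i)); rewrite inE => /andP[X1 /existsP[x /eqP E]].
by split=> //; exists x.
Qed.

Lemma summand_set_inj : injective summand_set.
Proof.
move=> i j Eij; have [_ [x Ex]] := summand_setP i; have [_ [y Ey]] := summand_setP j.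
have [M [_ MU]] := RP (summand_group i).
have Ei : M = summand_group i.
  by apply: MU; split; [exact: (valP i)|exists 1%g; rewrite conjsg1].
have Ej : M = summand_group j.
  apply: MU; split; first exact: (valP j).
  by exists (x * y^-1)%g; rewrite conjsgM -Ex Eij Ey conjsgK.
have {M MU Ei Ej} Eg : tag (val i) = tag (val j) by rewrite -[LHS]Ei.
apply: val_inj; move: Eij Eg; rewrite /summand_set.
case: (val i) (val j) => [L a] [L' b] /= + E; case: _ / E b => b.
by move/enum_val_inj->.
Qed.

Lemma summand_set_surj X : X \in P1 gT -> exists i, summand_set i = X.
Proof.
move=> X1; pose G := group (group_set_GX X).
have [M [[MR [x Ex]] _]] := RP G.
have XM : X \in [set X in P1 gT | [exists x : gT, GX X == (M :^ x)%g]].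
  rewrite inE X1; apply/existsP; exists x^-1%g.
  by rewrite Ex conjsgK.
pose p : {L : {group gT} & 'I_(qG L)} := Tagged (fun L => 'I_(qG L)) (enum_rank_in XM X).
by exists (Sub p MR); rewrite /summand_set SubK /= enum_rankK_in.
Qed.

Lemma sum_corners :
  isom_sum_corners (fun i : summand R => PX g (summand_group i)).
Proof.
have iso i : exists p : {linear Apar H -> Apar H} * {linear Apar H -> Apar H},
    [/\ {morph p.1 : x y / x * y} /\ {morph p.2 : x y / x * y},
      p.1 1 = PX g (summand_group i), p.2 1 = PX g (summand_set i),
      forall a, p.2 (p.1 a) = a * PX g (summand_set i) &
      forall a, p.1 (p.2 a) = a * PX g (summand_group i)].
  have [X1 [x Ex]] := summand_setP i.
  have [phi [psi ?]] := corner_iso_conj_stabilizer X1 Ex.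
  by exists (phi, psi).
have /boolp.choice[p pP] := iso.
pose f (a : Apar H) : {ffun summand R -> Apar H} := [ffun i => (p i).1 a].
have fl : linear f.
  by move=> c a b; apply/ffunP => i; rewrite !ffunE linearP.
exists (linear_of fl); split=> [a b /= Eab|y|i|a b i] /=.
- apply/eqP; rewrite -subr_eq0; apply/eqP/(PX_separate gP) => X /summand_set_surj[i <-].
  have Ei : (p i).1 a = (p i).1 b.
    by have := congr1 (fun y : {ffun _} => y i) Eab; rewrite !ffunE.
  by have [_ _ _ <- _] := pP i; rewrite linearB /= Ei subrr linear0.
- split=> [[a ->] i|yP].
    have [[M _] E _ _ _] := pP i; rewrite ffunE.
    by exists ((p i).1 a); rewrite -E -M mulr1.
  exists (\sum_j (p j).2 (y j)); apply/ffunP => i; rewrite ffunE linear_sum /=.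
  rewrite (bigD1 i) //= big1 ?addr0 => [|j ji].
    have [_ _ _ _ ->] := pP i; have [a ->] := yP i.
    by rewrite -mulrA (PX_central gP _).2.
  have [[M1 M2] E1 E2 K1 K2] := pP i; have [[_ M2j] _ E2j _ _] := pP j.
  have -> : (p j).2 (y j) = (p j).2 (y j) * PX g (summand_set j).
    by rewrite -E2j -M2j mulr1.
  (* (p i).1 factors through the corner of its own set, orthogonal to that of j. *)
  have C c : (p i).1 c = (p i).1 (c * PX g (summand_set i)).
    by rewrite -K1 K2 -E1 -M1 mulr1.
  rewrite C -mulrA (PX_orthogonal gP) ?mulr0 ?linear0 //.
  by apply: contra ji => /eqP/summand_set_inj->.
- by rewrite ffunE; have [_ -> _ _ _] := pP i.
- by rewrite !ffunE; have [[-> _] _ _ _ _] := pP i.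
Qed.

End Assembly.

Theorem corollary2p21 (K : fieldType) (H : hopfAlgType K)
    (H_pointed : pointed H)
    (antipode_inv : bijective (@antipode K H))
    (gT : finGroupType) (g : gT -> H) (gP : is_grouplike_group g)
    (R : {set {group gT}}) (RP : conjugacy_representatives R) :
  isom_sum_corners (fun i : summand R => PX g (summand_group i)).
Proof. exact: sum_corners. Qed.
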